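(* Let $\alpha\in\mathbb{R}$ and let $\rho$ be a nonzero $\sigma$-finite measure on $(0,\infty)$ such that $$\int_0^\infty \bigl(y^{\alpha-\delta}\vee y^{\alpha+\delta}\bigr)\,\rho(dy)<\infty\qquad\text{for some }\delta>0 .$$ Then $\rho$ has the cancellation property with respect to $\mathcal{N}=\{\nu_\alpha\}$ if and only if $$\int_0^\infty y^{\alpha+i\theta}\,\rho(dy)\neq 0\qquad\text{for all }\theta\in\mathbb{R}.$$ Furthermore, if $\int_0^\infty y^{\alpha+i\theta_0}\,\rho(dy)=0$ for some $\theta_0\in\mathbb{R}$, then for any real $a,b$ with $0<a^2+b^2\le 1$, the $\sigma$-finite measure $\nu(dx):=g(x)\,\nu_\alpha(dx)$ on $(0,\infty)$ with $$g(x):=1+a\cos(\theta_0\log x)+b\sin(\theta_0\log x),\qquad x>0,$$ satisfies the equation $\nu\circledast\rho=\nu_\alpha\circledast\rho$.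
   Context: For $\sigma$-finite measures $\nu,\rho$ on $(0,\infty)$, the multiplicative convolution $\nu\circledast\rho$ is the measure on $(0,\infty)$ defined by $(\nu\circledast\rho)(B)=\int_0^\infty \nu(x^{-1}B)\,\rho(dx)$ for Borel subsets $B$ of $(0,\infty)$. A $\sigma$-finite measure $\rho$ on $(0,\infty)$ has the cancellation property with respect to a family $\mathcal{N}$ of $\sigma$-finite measures on $(0,\infty)$ if for any $\sigma$-finite measures $\nu,\overline{\nu}$ on $(0,\infty)$ with $\overline{\nu}\in\mathcal{N}$, the equality $\nu\circledast\rho=\overline{\nu}\circledast\rho$ implies $\nu=\overline{\nu}$. For $\alpha\in\mathbb{R}$, $\nu_\alpha$ is the $\sigma$-finite measure on $(0,\infty)$ with Lebesgue density $|\alpha|x^{-(\alpha+1)}$ if $\alpha\ne 0$, and $x^{-1}$ if $\alpha=0$. Notation: $u\vee v=\max(u,v)$. *)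

(* Defs.v *)
From HB Require Import structures.
From mathcomp Require Import all_boot all_order all_algebra.
From mathcomp Require Import complex.
From mathcomp Require Import all_classical all_reals all_analysis.
From mathcomp Require Import measurable_realfun.
Set Implicit Arguments.
Unset Strict Implicit.
Unset Printing Implicit Defensive.
Import Order.TTheory GRing.Theory Num.Theory.
Import numFieldNormedType.Exports.
Local Open Scope classical_set_scope.
Local Open Scope complex_scope.
Local Open Scope ring_scope.
Local Open Scope ereal_scope.

(* A sigma-finite measure on (0, oo) is encoded as a sigma-finite Borel measure
   on R that gives no mass to ]-oo, 0]: extension by zero and restriction are
   mutually inverse.  Two such measures are identified when they agree on the
   Borel subsets of (0, oo); Leibniz equality would also compare the irrelevant
   values at non-measurable sets. *)
Record pos_measure (R : realType) := PosMeasure {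
  pos_measure_val :> {sigma_finite_measure set (measurableTypeR R) -> \bar R} ;
  pos_measure_npos : pos_measure_val `]-oo, 0%R]%classic = 0 }.

Definition eq_pos_measure (R : realType)
    (mu nu : set (measurableTypeR R) -> \bar R) : Prop :=
  forall B : set (measurableTypeR R),
    measurable B -> B `<=` `]0%R, +oo[ -> mu B = nu B.

Definition mconv (R : realType) (nu rho : pos_measure R)
    (B : set (measurableTypeR R)) : \bar R :=
  \int[rho]_(x in `]0%R, +oo[) nu [set (x^-1 * b)%R | b in B].

Definition cancellation_property (R : realType) (rho : pos_measure R)
    (N : set (pos_measure R)) : Prop :=
  forall nu nubar : pos_measure R, N nubar ->
    eq_pos_measure (mconv nu rho) (mconv nubar rho) -> eq_pos_measure nu nubar.

(* f(x) mu(dx) on (0, oo) *)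
Definition pos_density (R : realType)
    (mu : {measure set (measurableTypeR R) -> \bar R}) (f : R -> R)
    (B : set (measurableTypeR R)) : \bar R :=
  \int[mu]_(x in B `&` `]0%R, +oo[) (f x)%:E.

Definition nu_pdf (R : realType) (alpha x : R) : R :=
  (if alpha == 0 then x^-1 else `|alpha| * x `^ (- (alpha + 1)))%R.

Section nu_measure.
Context (R : realType) (alpha : R).

Definition nu_fun : set (measurableTypeR R) -> \bar R :=
  pos_density lebesgue_measure (nu_pdf alpha).

Let pdf_ge0 (x : R) : (0 < x -> 0 <= nu_pdf alpha x)%R.
Proof.
move=> x0; rewrite /nu_pdf; case: ifP => _; first by rewrite invr_ge0 ltW.
by rewrite mulr_ge0// powR_ge0.
Qed.

Let measurable_pdf : measurable_fun (`]0%R, +oo[ : set R) (nu_pdf alpha).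
Proof.
rewrite /nu_pdf; case: (alpha == 0%R).
  apply: (@eq_measurable_fun _ _ _ _ _ (fun x => x `^ (-1))%R).
    move=> x; rewrite inE/= in_itv/= andbT => x0.
    by rewrite powR_inv1// ltW.
  by apply: measurable_funTS; exact: measurable_powR.
apply: measurable_funTS; apply: measurable_funM => //.
Qed.

Let nu0 : nu_fun set0 = 0.
Proof. by rewrite /nu_fun /pos_density set0I integral_set0. Qed.

Let nu_ge0 B : 0 <= nu_fun B.
Proof.
apply: integral_ge0 => x [_ /=]; rewrite in_itv/= andbT => x0.
by rewrite lee_fin pdf_ge0.
Qed.

Let nu_sigma_additive : semi_sigma_additive nu_fun.
Proof.
move=> /= F mF tF mUF; rewrite /nu_fun /pos_density; apply: cvg_toP.
  apply: ereal_nondecreasing_is_cvgn => m n mn.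
  by apply: lee_sum_nneg_natr => // k _ _; exact: nu_ge0.
rewrite setI_bigcupl ge0_integral_bigcup//=.
- by move=> k; exact: measurableI.
- rewrite -setI_bigcupl; apply/measurable_EFinP.
  by apply: measurable_funS measurable_pdf => //; exact: subIsetr.
- move=> x [k _ [_ /=]]; rewrite in_itv/= andbT => x0.
  by rewrite lee_fin pdf_ge0.
- exact: trivIset_setIr.
Qed.

HB.instance Definition _ := isMeasure.Build _ _ _ nu_fun
  nu0 nu_ge0 nu_sigma_additive.

Let nu_npos : nu_fun `]-oo, 0%R]%classic = 0.
Proof.
rewrite /nu_fun /pos_density (_ : _ `&` _ = set0) ?integral_set0//.
apply/seteqP; split => // x /= []; rewrite !in_itv/= andbT => x0.
by rewrite ltNge x0.
Qed.

Let nu_sigma_finite : sigma_finite setT nu_fun.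
Proof.
pose G n : set R :=
  (`]0%R, +oo[ `&` nu_pdf alpha @^-1` `]-oo, n%:R]) `&` `[(- n%:R)%R, n%:R].
have mG n : measurable (G n).
  by apply: measurableI => //; exact: measurable_pdf.
exists (fun n => `]-oo, 0%R]%classic `|` G n).
  apply/esym/seteqP; split => // x _.
  have [x0|x0] := leP x 0%R; first by exists 0%N => //; left; rewrite /= in_itv.
  pose n := maxn (Num.truncn (nu_pdf alpha x)).+1 (Num.truncn x).+1.
  have lefn (y : R) : ((Num.truncn y).+1 <= n)%N -> (y <= n%:R)%R.
    by move=> yn; rewrite (le_trans (ltW (truncnS_gt y)))// ler_nat.
  exists n => //; right; rewrite /G /= !in_itv/= andbT x0.
  rewrite (lefn (nu_pdf alpha x)) ?leq_maxl// (lefn x) ?leq_maxr//.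
  by rewrite andbT; split=> //; rewrite (le_trans _ (ltW x0))// oppr_le0.
move=> n; split; first by apply: measurableU; [exact: measurable_itv|exact: mG].
apply: (@le_lt_trans _ _ (nu_fun `]-oo, 0%R]%classic + nu_fun (G n))).
  by apply: measureU2; [exact: measurable_itv|exact: mG].
rewrite nu_npos add0e /nu_fun /pos_density setIidl; last by move=> x [[]].
apply: (@le_lt_trans _ _ (\int[lebesgue_measure]_(x in G n) n%:R%:E)).
  apply: ge0_le_integral => //.
  - exact: mG.
  - move=> x [[+ _] _]; rewrite /= in_itv/= andbT => x0.
    by rewrite lee_fin pdf_ge0.
  - apply/measurable_EFinP.
    by apply: measurable_funS measurable_pdf => // x [[]].
  - by move=> x [[_ +] _]; rewrite /= in_itv/= lee_fin.
rewrite integral_cst; last exact: mG.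
rewrite lte_mul_pinfty ?lee_fin//.
apply: (@le_lt_trans _ _ (lebesgue_measure `[(- n%:R)%R, (n%:R : R)]%classic)).
  apply: le_measure; rewrite ?inE; last exact: subIsetr.
    exact: mG.
  exact: measurable_itv.
by rewrite lebesgue_measure_itv/=; case: ifP => _; rewrite -?EFinD ltry.
Qed.

HB.instance Definition _ := @Measure_isSigmaFinite.Build _ _ _
  nu_fun nu_sigma_finite.

Definition nu_measure : pos_measure R := @PosMeasure R nu_fun nu_npos.

End nu_measure.

(* y ^ z = exp (z log y), for y > 0 and z complex *)
Definition cpow (R : realType) (y : R) (z : R[i]) : R[i] :=
  let: u +i* v := z in
  ((expR (u * ln y) * cos (v * ln y)) +i* (expR (u * ln y) * sin (v * ln y)))%R.

(* Meaningful when the real and imaginary parts are integrable: Rintegral is 0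
   when the extended-real integral is infinite. *)
Definition cintegral (R : realType)
    (mu : {measure set (measurableTypeR R) -> \bar R})
    (D : set (measurableTypeR R)) (f : R -> R[i]) : R[i] :=
  (Rintegral mu D (fun y => complex.Re (f y)))
  +i* (Rintegral mu D (fun y => complex.Im (f y))).

Definition mellin (R : realType) (rho : pos_measure R) (z : R[i]) : R[i] :=
  cintegral rho `]0%R, +oo[ (fun y => cpow y z).

(* Main.v *)
Require Import Defs.
From HB Require Import structures.
From mathcomp Require Import all_boot all_order all_algebra.
From mathcomp Require Import complex.
From mathcomp Require Import all_classical all_reals all_analysis.
From mathcomp Require Import measurable_realfun ring lra.
Set Implicit Arguments.
Unset Strict Implicit.
Unset Printing Implicit Defensive.
Import Order.TTheory GRing.Theory Num.Theory.
Import numFieldNormedType.Exports.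
Local Open Scope classical_set_scope.
Local Open Scope complex_scope.
Local Open Scope ring_scope.

(** Taking logarithms turns the multiplicative convolution into an additive one.
Write r for the image under ln of y^alpha rho(dy).  The moment condition says
that r is a finite measure with exponential tails, and its Fourier transform at
theta is the Mellin integral C(theta) + i S(theta) of rho at alpha + i theta.
The measure nu_alpha is homogeneous: dilating it by y multiplies it by y^alpha
([nu_dilation]), so in logarithmic coordinates, after multiplication by
x^alpha, it is invariant under translations.

Sufficiency is a Wiener-type theorem.  Suppose that nu and nu_alpha have the
same convolution with rho.  For a continuous phi >= 0 with compact support, put
u(t) = int x^alpha phi(t - ln x) nu(dx); this is [tconv].  For nu_alpha this
function is a finite constant v, and equality of the convolutions says that
u - v is annihilated by convolution with r ([tconv_mconv]).  It is also bounded,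
because some compact set has positive rho-mass ([tconv_bounded]).  It remains to
see that a bounded continuous f with f * r = 0 vanishes
([wiener_annihilator]).  Since r has a second moment, C and S are twice
continuously differentiable, and since C + i S has no zero, the triangle
function supported on [-1, 1] may be divided by it; two integrations by parts
show that the quotient is the transform of a function h = O(1 / (1 + t^2)).
Thus h * r is the Fejer kernel ([fejer_factorization]), and Fubini gives
f * fejer = 0.  Rescaling r gives the same for the Fejer kernels of all scales,
and a dominated limit yields f(x) * int fejer = 0.  The Fejer kernel is explicit,
nonnegative and not almost everywhere 0, so no Fourier inversion is used.
Finally u = v for phi increasing to the indicator of an interval (weighted by
the appropriate power) gives nu = nu_alpha on the intervals ]p, q[ with 0 < p,
hence on all Borel sets ([cancel_nu]).

Conversely, if C(theta) = S(theta) = 0, the density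
g(x) = 1 + a cos(theta ln x) + b sin(theta ln x) is invisible to rho: by Tonelli
and homogeneity, nu * rho has the density z |-> int y^alpha g(z / y) rho(dy) with
respect to nu_alpha ([mconv_density]), and the addition formulas reduce this
integral to the total mass of r ([modulated_mass]).  With a = 1 and b = 0 the
density exceeds 1 on an interval ]1, q[, so that nu differs from nu_alpha and
cancellation fails. *)

(** * Fubini and translations for real-valued integrals *)

Section lebesgue_tools.
Context {R : realType}.
Notation leb := (@lebesgue_measure R).

(** Asking for integrability of every section, not just of almost every one,
makes all inner integrals finite, so that passing between real-valued and
extended inner integrals costs no null set. *)
Lemma Rintegral_Fubini d1 d2 (T1 : measurableType d1) (T2 : measurableType d2)
    (m1 : {sigma_finite_measure set T1 -> \bar R})
    (m2 : {sigma_finite_measure set T2 -> \bar R}) (f : T1 -> T2 -> R) :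
  measurable_fun [set: T1 * T2] (fun z => f z.1 z.2) ->
  (forall x, m2.-integrable setT (EFin \o f x)) ->
  (forall y, m1.-integrable setT (EFin \o f ^~ y)) ->
  (\int[m1]_x \int[m2]_y `|f x y|%:E < +oo)%E ->
  \int[m1]_x \int[m2]_y f x y = \int[m2]_y \int[m1]_x f x y.
Proof.
move=> mf i2 i1 ioo; rewrite /Rintegral; congr fine.
have fin2 x : (\int[m2]_y (f x y)%:E \is a fin_num)%E.
  exact: (integrable_fin_num measurableT (i2 x)).
have fin1 y : (\int[m1]_x (f x y)%:E \is a fin_num)%E.
  exact: (integrable_fin_num measurableT (i1 y)).
under eq_integral do rewrite fineK//.
under [RHS]eq_integral do rewrite fineK//.
apply: (@Fubini _ _ _ _ R m1 m2 (fun z => (f z.1 z.2)%:E)).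
apply/integrable12ltyP; first exact/measurable_EFinP.
by under eq_integral do under eq_integral do rewrite abse_EFin.
Qed.

Lemma lebesgue_measureD (s : R) (A : set R) : measurable A ->
  pushforward leb ((fun x => x - s) : R -> measurableTypeR R) A = leb A.
Proof.
move=> mA.
have ms : measurable_fun [set: R] ((fun x => x - s) : R -> measurableTypeR R).
  exact: measurable_funB.
apply/esym/lebesgue_measure_unique => //= _ [[a b]] _ <-.
rewrite /pushforward (_ : _ @^-1` _ = `]a + s, b + s]%classic); last first.
  by apply/seteqP; split=> x /=; rewrite !in_itv/= ltrBrDr lerBlDr.
rewrite !lebesgue_measure_itv/= !lte_fin ltrD2r.
by case: ifP => // _; rewrite -!EFinB; congr (_%:E); ring.
Qed.

Lemma ge0_integral_shift (g : R -> \bar R) (s : R) :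
  measurable_fun [set: R] g -> (forall x, 0 <= g x)%E ->
  (\int[leb]_v g (v - s)%R = \int[leb]_v g v)%E.
Proof.
move=> mg g0.
have ms : measurable_fun [set: R] ((fun x => x - s) : R -> measurableTypeR R).
  exact: measurable_funB.
rewrite -[LHS](@ge0_integral_pushforward _ _ (measurableTypeR R) (measurableTypeR R)
  R _ ms lebesgue_measure setT g)//=.
by apply: eq_measure_integral => //= A mA _; exact: lebesgue_measureD.
Qed.

Lemma integrable_shift (g : R -> R) (s : R) :
  leb.-integrable setT (EFin \o g) ->
  leb.-integrable setT (EFin \o (fun v => g (v - s))).
Proof.
move=> /integrableP[/measurable_EFinP mg ig]; apply/integrableP; split.
  by apply/measurable_EFinP; apply: measurableT_comp => //; exact: measurable_funB.
apply: le_lt_trans ig.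
rewrite -(@ge0_integral_shift (fun v => `|(EFin \o g) v|)%E s)//.
by apply: measurableT_comp => //; exact/measurable_EFinP.
Qed.

Lemma Rintegral_shift (g : R -> R) (s : R) :
  leb.-integrable setT (EFin \o g) ->
  \int[leb]_v g (v - s)%R = \int[leb]_v g v.
Proof.
move=> ig; rewrite /Rintegral; congr fine.
have ms : measurable_fun [set: R] ((fun x => x - s) : R -> measurableTypeR R).
  exact: measurable_funB.
have mg := measurable_int _ ig.
rewrite -[LHS](@integral_pushforward _ _ (measurableTypeR R) (measurableTypeR R)
  R _ ms lebesgue_measure setT (EFin \o g))//=.
- by apply: eq_measure_integral => //= A mA _; exact: lebesgue_measureD.
- exact: integrable_shift.
Qed.

End lebesgue_tools.

Section product_domination.
Context {R : realType}.

Lemma integrable_Mbounded d (T : measurableType d)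
    (mu : {measure set T -> \bar R}) (A c : T -> R) (M : R) :
  mu.-integrable setT (EFin \o A) -> measurable_fun setT c ->
  (forall x, `|c x| <= M) ->
  mu.-integrable setT (EFin \o (fun x => A x * c x)).
Proof.
move=> iA mc cM; have /measurable_EFinP mA := measurable_int _ iA.
apply: (@le_integrable _ _ _ mu setT measurableT _ (EFin \o (fun x => M * A x))).
- by apply/measurable_EFinP; exact: measurable_funM.
- move=> x _ /=; rewrite lee_fin !normrM mulrC ler_wpM2r//.
  by rewrite (le_trans (cM x))// ler_norm.
- have := integrableZl measurableT M iA.
  by apply: eq_integrable => // x _ /=; rewrite EFinM.
Qed.

(** The integrand is dominated by the product M |A| |B|, which gives all the
hypotheses of the general exchange at once. *)
Lemma Rintegral_Fubini_prod d1 d2 (T1 : measurableType d1) (T2 : measurableType d2)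
    (m1 : {sigma_finite_measure set T1 -> \bar R})
    (m2 : {sigma_finite_measure set T2 -> \bar R})
    (A : T1 -> R) (B : T2 -> R) (c : T1 -> T2 -> R) (M : R) :
  m1.-integrable setT (EFin \o A) -> m2.-integrable setT (EFin \o B) ->
  measurable_fun [set: T1 * T2] (fun z => c z.1 z.2) ->
  (forall x y, `|c x y| <= M) ->
  \int[m1]_x (A x * \int[m2]_y (B y * c x y)) =
  \int[m2]_y (B y * \int[m1]_x (A x * c x y)).
Proof.
move=> iA iB mc cM.
have mc1 x : measurable_fun setT (c x).
  exact: (@measurableT_comp _ _ _ _ _ _ _ _ (pair x) mc).
have mc2 y : measurable_fun setT (c ^~ y).
  exact: (@measurableT_comp _ _ _ _ _ _ _ _ (pair ^~ y) mc).
have /measurable_EFinP mA := measurable_int _ iA.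
have /measurable_EFinP mB := measurable_int _ iB.
have mnA : measurable_fun setT (fun x => `|(A x)%:E|%E).
  by apply/measurable_EFinP; exact: measurableT_comp.
have mnB : measurable_fun setT (fun x => `|(B x)%:E|%E).
  by apply/measurable_EFinP; exact: measurableT_comp.
have iBc x := integrable_Mbounded iB (mc1 x) (cM x).
have iAc y := integrable_Mbounded iA (mc2 y) (cM ^~ y).
transitivity (\int[m1]_x \int[m2]_y (A x * (B y * c x y))).
  by apply: eq_Rintegral => x _; rewrite RintegralZl.
transitivity (\int[m2]_y \int[m1]_x (A x * (B y * c x y))); last first.
  apply: eq_Rintegral => y _; rewrite -RintegralZl//.
  by apply: eq_Rintegral => x _; rewrite mulrCA.
apply: Rintegral_Fubini.
- apply: measurable_funM; first exact: measurableT_comp.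
  by apply: measurable_funM => //; exact: measurableT_comp.
- move=> x; have := integrableZl measurableT (A x) (iBc x).
  by apply: eq_integrable => // y _ /=; rewrite EFinM.
- move=> y; have := integrableZl measurableT (B y) (iAc y).
  by apply: eq_integrable => // x _ /=; rewrite -EFinM mulrCA.
- have [_ fA] := integrableP _ _ _ iA; have [_ fB] := integrableP _ _ _ iB.
  apply: (@le_lt_trans _ _ (\int[m1]_x (`|(A x)%:E| * (`|M|%:E * \int[m2]_y `|(B y)%:E|)))%E).
    apply: ge0_le_integral => //.
    - by move=> x _; exact: integral_ge0.
    - have mABc : measurable_fun [set: T1 * T2]
          (fun z => (`|A z.1 * (B z.2 * c z.1 z.2)|)%:E).
        apply/measurable_EFinP; apply: measurableT_comp => //.
        apply: measurable_funM; first exact: measurableT_comp.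
        by apply: measurable_funM => //; exact: measurableT_comp.
      by apply: (measurable_fun_fubini_tonelli_F _ mABc) => z; rewrite lee_fin.
    - apply: emeasurable_funM; last exact: measurable_cst.
      exact: mnA.
    - move=> x _.
      have mMB : measurable_fun setT (fun y => `|M|%:E * `|(B y)%:E|)%E.
        by apply: emeasurable_funM; [exact: measurable_cst|exact: mnB].
      rewrite -(ge0_integralZl m2 measurableT mnB)//.
      rewrite -(ge0_integralZl m2 measurableT mMB)//.
      apply: ge0_le_integral => //.
      + apply/measurable_EFinP; apply: measurableT_comp => //.
        by apply: measurable_funM => //; apply: measurable_funM.
      + by apply: emeasurable_funM; [exact: measurable_cst|exact: mMB].
      + move=> y _; rewrite lee_fin !normrM ler_wpM2l// mulrC ler_wpM2r//.
        by rewrite (le_trans (cM x y))// ler_norm.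
  rewrite (ge0_integralZr m1 measurableT mnA)//; last first.
  + by apply: mule_ge0 => //; exact: integral_ge0.
  apply: lte_mul_pinfty => //.
  + exact: integral_ge0.
  + rewrite ge0_fin_numE//; exact: integral_ge0.
  + apply: lte_mul_pinfty => //.
Qed.

End product_domination.

(** * Integration by parts for oscillating integrals *)

Section calculus.
Context {R : realType}.
Notation leb := (@lebesgue_measure R).

Lemma is_derive_continuous (F : R -> R) (x l : R) :
  is_derive x 1 F l -> {for x, continuous F}.
Proof. by move=> dF; apply/differentiable_continuous/derivable1_diffP. Qed.

Lemma is_derive_FTC2 (G g : R -> R) (a b : R) : a < b ->
  (forall x, x \in `[a, b] -> is_derive x 1 G (g x)) ->
  {within `[a, b], continuous g} ->
  (\int[leb]_(x in `[a, b]) (g x)%:E = (G b - G a)%:E)%E.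
Proof.
move=> ab dG cg; rewrite EFinB; apply: continuous_FTC2 => //.
  split.
  - by move=> x xab; have /dG[] := subset_itv_oo_cc xab.
  - apply: cvg_at_right_filter; apply: is_derive_continuous (dG a _).
    by rewrite bound_itvE ltW.
  - apply: cvg_at_left_filter; apply: is_derive_continuous (dG b _).
    by rewrite bound_itvE ltW.
move=> x xab; have := dG x (subset_itv_oo_cc xab).
by rewrite derive1E => ?; rewrite derive_val.
Qed.

Lemma continuous_integrable_segment (g : R -> R) (a b : R) : continuous g ->
  leb.-integrable `[a, b] (EFin \o g).
Proof.
move=> cg; apply: continuous_compact_integrable; first exact: segment_compact.
exact: continuous_subspaceT.
Qed.

Section derivation_rules.
Variables (f g : R -> R) (x a b : R).

Lemma der_comp : is_derive (g x) 1 f a -> is_derive x 1 g b ->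
  is_derive x 1 (fun y => f (g y)) (a * b).
Proof. by move=> df dg; exact: is_derive1_comp. Qed.

Hypotheses (df : is_derive x 1 f a) (dg : is_derive x 1 g b).

Lemma derD : is_derive x 1 (fun y => f y + g y) (a + b).
Proof. exact: is_deriveD. Qed.

Lemma derN : is_derive x 1 (fun y => - f y) (- a).
Proof. exact: is_deriveN. Qed.

Lemma derM : is_derive x 1 (fun y => f y * g y) (a * g x + f x * b).
Proof.
have := is_deriveM df dg; rewrite /GRing.scale/= => H.
by apply: (is_derive_eq H); rewrite addrC [g x * a]mulrC.
Qed.

Lemma derV : f x != 0 -> is_derive x 1 (fun y => (f y)^-1) (- a / f x ^+ 2).
Proof.
move=> fx0; have [d e] := df; apply: DeriveDef; first exact: derivableV.
by rewrite (deriveV fx0 d) e /GRing.scale/= mulNr mulNr mulrC.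
Qed.

End derivation_rules.

Lemma der_cst (c x : R) : is_derive x 1 (fun=> c : R) 0.
Proof. exact: is_derive_cst. Qed.

Section parts.
Variables (F F1 F2 : R -> R) (t phi : R).
Hypotheses (dF : forall x : R, is_derive x 1 F (F1 x))
  (dF1 : forall x : R, is_derive x 1 F1 (F2 x)) (cF2 : continuous F2) (t0 : t != 0).

Let cF : continuous F.
Proof. by move=> x; exact: is_derive_continuous (dF x). Qed.

Let ccos : continuous (fun x => cos (t * x + phi)).
Proof.
move=> x; apply: continuous_comp; last exact: continuous_cos.
by apply: cvgD; [apply: cvgM; [exact: cvg_cst|exact: cvg_id]|exact: cvg_cst].
Qed.

Let cFc (K : R -> R) : continuous K -> continuous (fun x => K x * cos (t * x + phi)).
Proof. by move=> cK x; apply: cvgM; [exact: cK|exact: ccos]. Qed.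

(** Two integrations by parts done at once: the function
F(x) sin(t x + phi) / t + F'(x) cos(t x + phi) / t^2 has the derivative
(F + F'' / t^2) cos(t x + phi). *)
Lemma cos_integral_by_parts :
  \int[leb]_(x in `[0, 1]) (F x * cos (t * x + phi)) =
  F 1 * sin (t + phi) / t - F 0 * sin phi / t
  + (F1 1 * cos (t + phi) - F1 0 * cos phi) / t ^+ 2
  - (\int[leb]_(x in `[0, 1]) (F2 x * cos (t * x + phi))) / t ^+ 2.
Proof.
pose G x := F x * sin (t * x + phi) / t + F1 x * cos (t * x + phi) / t ^+ 2.
pose g x := F x * cos (t * x + phi) + F2 x * cos (t * x + phi) / t ^+ 2.
have dG (x : R) : is_derive x 1 G (g x).
  have Hl : is_derive x 1 (fun x => t * x + phi) t.
    have := derD (derM (der_cst t x) (is_derive_id x 1)) (der_cst phi x).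
    by rewrite mul0r add0r addr0 mulr1.
  have Hs := @der_comp sin (fun x => t * x + phi) x _ _ (is_derive_sin _) Hl.
  have Hc := @der_comp cos (fun x => t * x + phi) x _ _ (is_derive_cos _) Hl.
  have := derD (derM (derM (dF x) Hs) (der_cst t^-1 x))
               (derM (derM (dF1 x) Hc) (der_cst (t ^+ 2)^-1 x)).
  move=> H; apply: (is_derive_eq H).
  by rewrite /g; field.
have cg : continuous g.
  move=> x; apply: cvgD; first exact: cFc.
  by apply: cvgMr_tmp; exact: cFc.
have FTC : \int[leb]_(x in `[0, 1]) g x = G 1 - G 0.
  rewrite /Rintegral (@is_derive_FTC2 G g)//.
  exact: continuous_subspaceT.
have iF := continuous_integrable_segment 0 1 (cFc cF).
have iF2 := continuous_integrable_segment 0 1 (cFc cF2).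
move: FTC; rewrite RintegralD//; last first.
  by apply: continuous_integrable_segment => x; apply: cvgMr_tmp; exact: cFc.
rewrite RintegralZr// /G !mulr1 !mulr0 !add0r => /eqP.
rewrite eq_sym -subr_eq => /eqP <-.
by ring.
Qed.

End parts.
End calculus.

(** * Twice continuously differentiable functions *)

Section C2.
Context {R : realType}.
Notation leb := (@lebesgue_measure R).

(** The derivatives are exhibited as functions with [is_derive] rather than
taken with the derivation operator, so that the closure properties are
computations with the Leibniz rules. *)
Definition C2 (F : R -> R) := exists F1 F2 : R -> R,
  [/\ forall x : R, is_derive x 1 F (F1 x),
      forall x : R, is_derive x 1 F1 (F2 x) & continuous F2].

Lemma C2_continuous F : C2 F -> continuous F.
Proof. by move=> [F1 [F2 [dF _ _]]] x; exact: is_derive_continuous (dF x). Qed.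

Lemma C2D F G : C2 F -> C2 G -> C2 (fun x => F x + G x).
Proof.
move=> [F1 [F2 [dF dF1 cF]]] [G1 [G2 [dG dG1 cG]]].
exists (fun x => F1 x + G1 x), (fun x => F2 x + G2 x); split.
- by move=> x; exact: derD.
- by move=> x; exact: derD.
- by move=> x; apply: cvgD; [exact: cF|exact: cG].
Qed.

Lemma C2M F G : C2 F -> C2 G -> C2 (fun x => F x * G x).
Proof.
move=> [F1 [F2 [dF dF1 cF]]] [G1 [G2 [dG dG1 cG]]].
have c (H h : R -> R) : (forall x : R, is_derive x 1 H (h x)) -> continuous H.
  by move=> dH x; exact: is_derive_continuous (dH x).
exists (fun x => F1 x * G x + F x * G1 x),
  (fun x => (F2 x * G x + F1 x * G1 x) + (F1 x * G1 x + F x * G2 x)); split.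
- by move=> x; exact: derM.
- by move=> x; apply: derD; exact: derM.
- by move=> x; apply: cvgD; apply: cvgD; apply: cvgM;
    [exact: cF|exact: (c _ _ dG)|exact: (c _ _ dF1)|exact: (c _ _ dG1)
    |exact: (c _ _ dF1)|exact: (c _ _ dG1)|exact: (c _ _ dF)|exact: cG].
Qed.

Lemma C2_cst c : C2 (fun=> c).
Proof.
exists (fun=> 0), (fun=> 0).
by split=> x; [exact: der_cst|exact: der_cst|exact: cvg_cst].
Qed.

Lemma C2_id : C2 id.
Proof.
exists (fun=> 1), (fun=> 0).
by split=> x; [exact: is_derive_id|exact: der_cst|exact: cvg_cst].
Qed.

Lemma C2V F : C2 F -> (forall x, F x != 0) -> C2 (fun x => (F x)^-1).
Proof.
move=> [F1 [F2 [dF dF1 cF]]] F0.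
have c (H h : R -> R) : (forall x : R, is_derive x 1 H (h x)) -> continuous H.
  by move=> dH x; exact: is_derive_continuous (dH x).
pose V x := (F x)^-1.
have dV (x : R) : is_derive x 1 V (- F1 x * (V x * V x)).
  by apply: (is_derive_eq (derV (dF x) (F0 x))); rewrite /V -expr2 exprVn.
exists (fun x => - F1 x * (V x * V x)).
exists (fun x => - F2 x * (V x * V x) + - F1 x *
  ((- F1 x * (V x * V x)) * V x + V x * (- F1 x * (V x * V x)))); split.
- exact: dV.
- by move=> x; exact: (derM (derN (dF1 x)) (derM (dV x) (dV x))).
- have cV := c _ _ dV; have cF1 := c _ _ dF1.
  move=> x; apply: cvgD; apply: cvgM;
    [apply: cvgN; exact: cF|apply: cvgM; exact: cV|apply: cvgN; exact: cF1|].
  by apply: cvgD; apply: cvgM; [apply: cvgM|exact: cV|exact: cV|apply: cvgM];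
    [apply: cvgN; exact: cF1|apply: cvgM; exact: cV
    |apply: cvgN; exact: cF1|apply: cvgM; exact: cV].
Qed.

(** The boundary terms F(1) sin(t + phi) / t and F(0) sin(phi) / t are the only
ones of order 1 / t; the hypotheses remove them.  The phase makes this cover the
sine transform, where it is F(0) = 0 that is needed. *)
Lemma cos_integral_decay F phi : C2 F -> F 1 = 0 -> F 0 * sin phi = 0 ->
  exists2 K, 0 <= K & forall t,
    `|\int[leb]_(x in `[0, 1]) (F x * cos (t * x + phi))| <= K * (1 + t ^+ 2)^-1.
Proof.
move=> C2F F10 F0s; have [F1 [F2 [dF dF1 cF2]]] := C2F.
have cF := C2_continuous C2F.
have bnd (G : R -> R) t : continuous G ->
    `|\int[leb]_(x in `[0, 1]) (G x * cos (t * x + phi))| <=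
    \int[leb]_(x in `[0, 1]) `|G x|.
  move=> cG; have iG := continuous_integrable_segment 0 1 cG.
  have iGc : leb.-integrable `[0, 1] (EFin \o (fun x => G x * cos (t * x + phi))).
    apply: continuous_integrable_segment => x.
    apply: cvgM; first exact: cG.
    apply: continuous_comp; last exact: continuous_cos.
    by apply: cvgD; [apply: cvgM; [exact: cvg_cst|exact: cvg_id]|exact: cvg_cst].
  apply: (le_trans (le_normr_Rintegral _ iGc)) => //.
  apply: le_Rintegral => //.
  - exact: (integrable_norm iGc).
  - exact: (integrable_norm iG).
  - by move=> x _; rewrite normrM ler_piMr// ler_norml cos_geN1 cos_le1.
pose K0 := \int[leb]_(x in `[0, 1]) `|F x|.
pose K2 := \int[leb]_(x in `[0, 1]) `|F2 x|.
pose K1 := `|F1 1| + `|F1 0| + K2.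
have K00 : 0 <= K0 by apply: Rintegral_ge0.
have K20 : 0 <= K2 by apply: Rintegral_ge0.
have K10 : 0 <= K1 by rewrite /K1 !addr_ge0.
exists (K0 + K1); first exact: addr_ge0.
move=> t; rewrite ler_pdivlMr; last by rewrite ltr_pwDl// sqr_ge0.
have H0 := bnd F t cF.
set I := Rintegral _ _ _ in H0 *.
rewrite mulrDr mulr1 lerD//.
have [->|t0] := eqVneq t 0; first by rewrite expr0n/= mulr0.
have t2 : 0 < t ^+ 2 by rewrite exprn_even_gt0.
rewrite -ler_pdivlMr// /I (cos_integral_by_parts _ dF dF1)// F10 F0s !mul0r subrr add0r.
have t2V : 0 < (t ^+ 2)^-1 by rewrite invr_gt0.
rewrite -mulrBl normrM (gtr0_norm t2V) ler_pM2r//.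
apply: (le_trans (ler_normB _ _)); apply: lerD; last exact: bnd.
by apply: (le_trans (ler_normB _ _)); apply: lerD; rewrite normrM ler_piMr//
  ler_norml cos_geN1 cos_le1.
Qed.

End C2.

(** * Cosine transforms of integrable weights *)

Section trig_transform.
Context {R : realType} d (T : measurableType d).
Variables (mu : {measure set T -> \bar R}) (X : T -> R).
Hypothesis mX : measurable_fun setT X.

(** The phase phi treats the cosine and the sine transform together: phi = 0
gives the first, phi = - pi / 2 the second, and differentiation in theta amounts
to multiplying A by X and adding pi / 2 to phi. *)
Definition trig_tr (A : T -> R) (phi theta : R) :=
  \int[mu]_w (A w * cos (theta * X w + phi)).

Lemma measurable_cosX phi theta : measurable_fun setT (fun w => cos (theta * X w + phi)).
Proof.
apply: measurableT_comp; first (apply: continuous_measurable_fun; exact: continuous_cos).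
by apply: measurable_funD => //; exact: measurable_funM.
Qed.

Lemma integrable_cosX A phi theta : mu.-integrable setT (EFin \o A) ->
  mu.-integrable setT (EFin \o (fun w => A w * cos (theta * X w + phi))).
Proof.
move=> iA; have /measurable_EFinP mA := measurable_int _ iA.
apply: le_integrable iA => //.
  apply/measurable_EFinP; apply: measurable_funM => //; exact: measurable_cosX.
by move=> w _ /=; rewrite lee_fin normrM ler_piMr// cos_max.
Qed.

Lemma trig_tr_continuous A phi : mu.-integrable setT (EFin \o A) ->
  continuous (trig_tr A phi).
Proof.
move=> iA x.
have := @continuity_under_integral R _ T mu
  (fun theta w => A w * cos (theta * X w + phi)) setT measurableT (x - 1) (x + 1).
move=> /(_ (fun t _ => integrable_cosX phi t iA)).
have cf : {ae mu, forall w, setT w -> {in `]x - 1, x + 1[%classic, continuous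
    (fun theta : R => A w * cos (theta * X w + phi))}}.
  apply: aeW => w _ y _; apply: cvgMl_tmp.
  apply: (@continuous_comp _ _ _ (fun y : R => y * X w + phi) cos); last exact: continuous_cos.
  by apply: cvgD; [apply: cvgMr_tmp; exact: cvg_id|exact: cvg_cst].
move=> /(_ cf (fun w => `|A w|) (integrable_norm iA)); apply.
  move=> y _; apply: aeW => w _.
  by rewrite normrM ler_piMr// cos_max.
by rewrite inE/= in_itv/=; apply/andP; split; lra.
Qed.

Lemma trig_tr_derive A phi (theta : R) : mu.-integrable setT (EFin \o A) ->
  mu.-integrable setT (EFin \o (fun w => A w * X w)) ->
  is_derive theta 1 (trig_tr A phi) (trig_tr (fun w => A w * X w) (phi + pi / 2) theta).
Proof.
move=> iA iAX.
pose f (t : R) w := A w * cos (t * X w + phi).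
have df (t : R) w : is_derive t 1 (f^~ w) (A w * X w * cos (t * X w + (phi + pi / 2))).
  have Hl : is_derive t 1 (fun t : R => t * X w + phi) (X w).
    have := derD (derM (is_derive_id t 1) (der_cst (X w) t)) (der_cst phi t).
    by rewrite mul1r mulr0 !addr0.
  have Hc := @der_comp R cos (fun t => t * X w + phi) t _ _ (is_derive_cos _) Hl.
  apply: (is_derive_eq (derM (der_cst (A w) t) Hc)).
  by rewrite addrA cosDpihalf; ring.
have Ith : theta \in `]theta - 1, theta + 1[.
  by rewrite in_itv/=; apply/andP; split; lra.
have d1 (t : R) w : partial1of2 f t w = A w * X w * cos (t * X w + (phi + pi / 2)).
  by rewrite partial1of2E; have := df t w => ?; rewrite derive_val.
have intf t (_ : t \in `]theta - 1, theta + 1[) : mu.-integrable setT (EFin \o f t).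
  exact: integrable_cosX.
have derf t w : t \in `]theta - 1, theta + 1[ -> setT w -> derivable (f^~ w) t 1.
  by move=> _ _; have [] := df t w.
have Gub t w : t \in `]theta - 1, theta + 1[ -> setT w ->
    `|partial1of2 f t w| <= `|A w * X w|.
  by move=> _ _; rewrite d1 normrM ler_piMr// cos_max.
have G0 w : 0 <= `|A w * X w| by [].
apply: DeriveDef.
  exact: (derivable_under_integral measurableT Ith intf derf G0
    (integrable_norm iAX) Gub).
rewrite -derive1E.
rewrite (differentiation_under_integral measurableT Ith intf derf G0
    (integrable_norm iAX) Gub).
by apply: eq_Rintegral => w _; rewrite -d1.
Qed.

Lemma trig_tr_C2 A phi : mu.-integrable setT (EFin \o A) ->
  mu.-integrable setT (EFin \o (fun w => A w * X w)) ->
  mu.-integrable setT (EFin \o (fun w => A w * X w * X w)) ->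
  C2 (trig_tr A phi).
Proof.
move=> iA iAX iAXX.
exists (trig_tr (fun w => A w * X w) (phi + pi / 2)).
exists (trig_tr (fun w => A w * X w * X w) (phi + pi / 2 + pi / 2)).
split=> [x|x|]; [exact: trig_tr_derive|exact: trig_tr_derive|].
exact: trig_tr_continuous.
Qed.

End trig_transform.

(** * Band-limited transforms and the Fejer kernel *)

Section fejer_kernel.
Context {R : realType}.
Notation leb := (@lebesgue_measure R).

(** Since only the frequencies in [0, 1] contribute, this is a cosine transform
of the Lebesgue measure itself, to which the results on [trig_tr] apply. *)
Definition band_tr (F : R -> R) (phi t : R) : R :=
  trig_tr leb idfun (F \_ `[0, 1]) phi t.

Lemma band_trE F phi t :
  band_tr F phi t = \int[leb]_(x in `[0, 1]) (F x * cos (t * x + phi)).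
Proof.
rewrite /band_tr /trig_tr [RHS]Rintegral_mkcond; apply: eq_Rintegral => x _.
by rewrite !patchE; case: ifPn; rewrite ?mul0r.
Qed.

Lemma integrable_patch (a b : R) (F : R -> R) : continuous F ->
  leb.-integrable setT (EFin \o (F \_ `[a, b])).
Proof.
move=> cF; have := continuous_integrable_segment a b cF.
rewrite integrable_mkcond//.
by apply: eq_integrable => // x _; rewrite /= !patchE; case: ifP.
Qed.

Lemma measurable_band_tr F phi : continuous F -> measurable_fun setT (band_tr F phi).
Proof.
move=> cF; apply: continuous_measurable_fun; apply: trig_tr_continuous; [exact: measurable_id|].
exact: integrable_patch.
Qed.

Lemma integrable_oneDsqrV :
  leb.-integrable setT (EFin \o (fun x : R => (1 + x ^+ 2)^-1)).
Proof.
have c : continuous (fun x : R => (1 + x ^+ 2)^-1) by exact: continuous_oneDsqrV.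
have p (x : R) : 0 <= (1 + x ^+ 2)^-1 by rewrite invr_ge0 addr_ge0// sqr_ge0.
apply/integrableP; split.
  by apply/measurable_EFinP; exact: continuous_measurable_fun.
under eq_integral => x _ do rewrite /= ger0_norm//.
rewrite ge0_symfun_integralT//; last by move=> x /=; rewrite sqrrN.
rewrite -set_itvcy (_ : (\int[_]_(_ in _) _ = (pi / 2)%:E)%E) ?ltry//.
exact: integral0y_oneDsqr.
Qed.

Lemma integrable_decay (h : R -> R) K : measurable_fun setT h ->
  (forall t, `|h t| <= K * (1 + t ^+ 2)^-1) ->
  leb.-integrable setT (EFin \o h).
Proof.
move=> mh hK; apply: (@le_integrable _ _ _ leb setT measurableT _
    (EFin \o (fun x => K * (1 + x ^+ 2)^-1))).
- exact/measurable_EFinP.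
- by move=> x _ /=; rewrite lee_fin (le_trans (hK x))// ler_norm.
- have := integrableZl measurableT K integrable_oneDsqrV.
  by apply: eq_integrable => // x _ /=; rewrite EFinM.
Qed.

Lemma decay_bounded (K x t : R) : 0 <= K -> x <= K * (1 + t ^+ 2)^-1 -> x <= K.
Proof.
move=> K0 /le_trans; apply; rewrite ler_piMr// invf_le1 ?lerDl ?sqr_ge0//.
by rewrite ltr_pwDl// sqr_ge0.
Qed.

(** Half the Fourier transform of the triangle function 1 - |x| on [-1, 1]. *)
Definition fejer : R -> R := band_tr (fun x => 1 - x) 0.

Lemma C2_onem : C2 (fun x : R => 1 - x).
Proof.
have -> : (fun x : R => 1 - x) = (fun x => 1 + (-1) * x).
  by apply/funext => x; rewrite mulN1r.
by apply: C2D; [exact: C2_cst|apply: C2M; [exact: C2_cst|exact: C2_id]].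
Qed.

Lemma measurable_fejer : measurable_fun setT fejer.
Proof. by apply: measurable_band_tr; exact: C2_continuous C2_onem. Qed.

Lemma integrable_fejer : leb.-integrable setT (EFin \o fejer).
Proof.
have [||K K0 HK] := @cos_integral_decay R (fun x => 1 - x) 0 C2_onem.
- by rewrite subrr.
- by rewrite sin0 mulr0.
apply: (@integrable_decay _ K); first exact: measurable_fejer.
by move=> t; rewrite /fejer band_trE.
Qed.

Lemma fejerE t : t != 0 -> fejer t = (1 - cos t) / t ^+ 2.
Proof.
move=> t0; rewrite /fejer band_trE.
have dF (x : R) : is_derive x 1 (fun x : R => 1 - x) (-1).
  have := derD (der_cst 1 x) (derN (is_derive_id x 1)).
  by rewrite add0r.
rewrite (cos_integral_by_parts 0 dF (der_cst (-1)))//; last by move=> x; exact: cvg_cst.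
rewrite (@eq_Rintegral _ _ _ _ _ (cst 0)); last by move=> x _; rewrite mul0r.
rewrite Rintegral_cst//= sin0 cos0 addr0 subrr !mul0r !mulr0 !mul0r subrr add0r subr0.
by rewrite mulr1 mulN1r opprK addrC.
Qed.

Lemma fejer_ge0 t : 0 <= fejer t.
Proof.
have [->|t0] := eqVneq t 0.
  rewrite /fejer band_trE; apply: Rintegral_ge0 => x /=; rewrite in_itv/= => /andP[_ x1].
  by rewrite mul0r addr0 cos0 mulr1 subr_ge0.
by rewrite fejerE// divr_ge0 ?sqr_ge0// subr_ge0 cos_le1.
Qed.

(** On [1, 2] the kernel is at least (1 - cos 1) / 4. *)
Lemma Rintegral_fejer_gt0 : 0 < \int[leb]_v fejer v.
Proof.
have c1 : cos 1 < 1 :> R.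
  have p1 := @pihalf_ge1 R.
  have i1 : (1 : R) \in `[0, pi] by rewrite in_itv/=; apply/andP; split; lra.
  have i0 : (0 : R) \in `[0, pi] by rewrite in_itv/=; apply/andP; split; lra.
  by rewrite -[ltRHS]cos0 (ltr_cos i0 i1).
pose c : R := (1 - cos 1) / 4.
have c0 : 0 < c by rewrite divr_gt0// subr_gt0.
suff : c <= \int[leb]_v fejer v by exact: lt_le_trans.
have -> : c = \int[leb]_v (cst c \_ `[1, 2]) v.
  rewrite -Rintegral_mkcond Rintegral_cst//= lebesgue_measure_itv/= lte_fin.
  by rewrite ifT ?ltr1n//=; ring.
apply: le_Rintegral => //.
- exact: (integrable_patch 1 2 (C2_continuous (C2_cst c))).
- exact: integrable_fejer.
- move=> v _; rewrite patchE; case: ifPn => [|_]; last exact: fejer_ge0.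
  rewrite inE/= in_itv/= => /andP[v1 v2].
  rewrite fejerE; last by apply/eqP => v0; move: v1; rewrite v0 ler10.
  rewrite /c; apply: ler_pM.
  + by rewrite subr_ge0 cos_le1.
  + by rewrite invr_ge0.
  + rewrite lerB//; move: v1; rewrite le_eqVlt => /predU1P[<-//|v1].
    have p1 := @pihalf_ge1 R.
    have i1 : (1 : R) \in `[0, pi] by rewrite in_itv/=; apply/andP; split; lra.
    have iv : v \in `[0, pi] by rewrite in_itv/=; apply/andP; split; lra.
    by rewrite ltW// (ltr_cos i1 iv).
  + rewrite lef_pV2 ?posrE//; last by rewrite exprn_gt0//; lra.
    by rewrite (_ : 4 = 2 ^+ 2 :> R); [rewrite ler_sqr ?nnegrE//; lra|ring].
Qed.

End fejer_kernel.

(** * A Wiener theorem for weights with a second moment *)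

Section factorization.
Context {R : realType} d (T : measurableType d).
Variables (mu : {sigma_finite_measure set T -> \bar R}) (X W : T -> R).
Hypotheses (mX : measurable_fun setT X) (iW : mu.-integrable setT (EFin \o W))
  (iWXX : mu.-integrable setT (EFin \o (fun w => W w * X w * X w))).
Notation leb := (@lebesgue_measure R).

Lemma integrable_first_moment :
  mu.-integrable setT (EFin \o (fun w => W w * X w)).
Proof.
have /measurable_EFinP mW := measurable_int _ iW.
apply: (@le_integrable _ _ _ mu setT measurableT _
    (EFin \o (fun w => `|W w| + `|W w * X w * X w|))).
- by apply/measurable_EFinP; exact: measurable_funM.
- move=> w _ /=; rewrite lee_fin [leRHS]ger0_norm ?addr_ge0// !normrM.
  rewrite -mulrA -{2}[`|W w|]mulr1 -mulrDr ler_wpM2l//.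
  by have := normr_ge0 (X w); nra.
- have := integrableD measurableT (integrable_norm iW) (integrable_norm iWXX).
  by apply: eq_integrable => // w _.
Qed.

Hypothesis nz : forall theta,
  trig_tr mu X W 0 theta ^+ 2 + trig_tr mu X W (- (pi / 2)) theta ^+ 2 != 0.

Let C := trig_tr mu X W 0.
Let S := trig_tr mu X W (- (pi / 2)).

Lemma trig_tr_phase a theta :
  trig_tr mu X W (- a) theta = cos a * C theta + sin a * S theta.
Proof.
rewrite /C /S /trig_tr.
have i0 := integrable_cosX mX 0 theta iW.
have ip := integrable_cosX mX (- (pi / 2)) theta iW.
rewrite -RintegralZl// -RintegralZl// -RintegralD//; last 2 first.
- have := integrableZl measurableT (cos a) i0.
  by apply: eq_integrable => // w _ /=; rewrite EFinM.
- have := integrableZl measurableT (sin a) ip.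
  by apply: eq_integrable => // w _ /=; rewrite EFinM.
by apply: eq_Rintegral => w _; rewrite cosB cosBpihalf addr0; ring.
Qed.

(** Convolution on one side is multiplication on the other: the inner integral of
the exchanged double integral is the transform of W at the frequency x. *)
Lemma band_tr_conv F phi t : continuous F ->
  \int[mu]_w (W w * band_tr F phi (t - X w)) =
  \int[leb]_(x in `[0, 1]) (F x * trig_tr mu X W (- (t * x + phi)) x).
Proof.
move=> cF; rewrite [RHS]Rintegral_mkcond /band_tr /trig_tr.
rewrite (@Rintegral_Fubini_prod R _ _ T _ mu leb W (F \_ `[0, 1])
  (fun w x => cos ((t - X w) * idfun x + phi)) 1)//.
- apply: eq_Rintegral => x _; rewrite patchE [RHS]patchE.
  case: ifPn => _; last by rewrite mul0r.
  congr (_ * _); apply: eq_Rintegral => w _; congr (_ * _).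
  by rewrite -cosN; congr cos; rewrite /=; ring.
- exact: integrable_patch.
- apply: measurableT_comp; first (apply: continuous_measurable_fun; exact: continuous_cos).
  apply: measurable_funD => //; apply: measurable_funM => //.
    by apply: measurable_funB => //; exact: measurableT_comp.
  exact: measurable_snd.
- by move=> w x; exact: cos_max.
Qed.

(** Division on the Fourier side: h(t) is the integral over [0, 1] of
(1 - x) Re (exp(i t x) / (C(x) - i S(x))).  As the triangle function has compact
support, it is enough that C and S are twice continuously differentiable and
that C^2 + S^2 does not vanish.  The kink of the triangle function at 0 does no
harm: there the cosine part has no boundary term of order 1 / t, and the
coefficient S of the sine part vanishes. *)
Lemma fejer_factorization : exists2 h : R -> R,
  measurable_fun setT h /\
    (exists2 K, 0 <= K & forall t, `|h t| <= K * (1 + t ^+ 2)^-1) &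
  forall t, \int[mu]_w (W w * h (t - X w)) = fejer t.
Proof.
pose D x := C x ^+ 2 + S x ^+ 2.
have iWX := integrable_first_moment.
have C2C : C2 C by exact: trig_tr_C2.
have C2S : C2 S by exact: trig_tr_C2.
have C2D : C2 D by apply: C2D; exact: C2M.
have C2k (F : R -> R) : C2 F -> C2 (fun x => (1 - x) * (F x / D x)).
  by move=> C2F; apply: C2M; [exact: C2_onem|apply: C2M => //; exact: C2V].
pose FC x := (1 - x) * (C x / D x).
pose FS x := (1 - x) * (S x / D x).
have S0 : S 0 = 0.
  rewrite /S /trig_tr (@eq_Rintegral _ _ _ _ _ (cst 0)); last first.
    by move=> w _ /=; rewrite cosBpihalf mul0r sin0 mulr0.
  by rewrite /Rintegral integral0.
have [||K1 K10 HK1] := @cos_integral_decay R FC 0 (C2k _ C2C).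
- by rewrite /FC subrr mul0r.
- by rewrite sin0 mulr0.
have [||K2 K20 HK2] := @cos_integral_decay R FS (pi / 2) (C2k _ C2S).
- by rewrite /FS subrr mul0r.
- by rewrite /FS S0 !mul0r mulr0 mul0r.
have cFC : continuous FC by apply: C2_continuous; exact: C2k.
have cFS : continuous FS by apply: C2_continuous; exact: C2k.
have m1 := measurable_band_tr 0 cFC; have m2 := measurable_band_tr (pi / 2) cFS.
have b1 t : `|band_tr FC 0 t| <= K1 by rewrite band_trE; exact: decay_bounded K10 (HK1 t).
have b2 t : `|band_tr FS (pi / 2) t| <= K2 by rewrite band_trE; exact: decay_bounded K20 (HK2 t).
(* The phase pi / 2 turns the cosine into - sin, the sign that makes the cross
   terms C S cancel below. *)
exists (fun t => band_tr FC 0 t + band_tr FS (pi / 2) t).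
  split; first exact: measurable_funD.
  exists (K1 + K2); first exact: addr_ge0.
  move=> t; apply: (le_trans (ler_normD _ _)); rewrite [leRHS]mulrDl; apply: lerD.
    by rewrite band_trE; exact: HK1.
  by rewrite band_trE; exact: HK2.
move=> t; have mtX : measurable_fun setT (fun w => t - X w) by exact: measurable_funB.
under eq_Rintegral => w _ do rewrite mulrDr.
rewrite RintegralD//; last 2 first.
- by apply: (integrable_Mbounded iW _ (M := K1)) => //; exact: measurableT_comp.
- by apply: (integrable_Mbounded iW _ (M := K2)) => //; exact: measurableT_comp.
rewrite !band_tr_conv//.
have cC := C2_continuous C2C; have cS := C2_continuous C2S.
have ccos (a : R) : continuous (fun x : R => cos (t * x + a)).
  move=> x; apply: (@continuous_comp _ _ _ (fun x : R => t * x + a) cos).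
    by apply: cvgD; [apply: cvgMl_tmp; exact: cvg_id|exact: cvg_cst].
  exact: continuous_cos.
have csin (a : R) : continuous (fun x : R => sin (t * x + a)).
  move=> x; apply: (@continuous_comp _ _ _ (fun x : R => t * x + a) sin).
    by apply: cvgD; [apply: cvgMl_tmp; exact: cvg_id|exact: cvg_cst].
  exact: continuous_sin.
have ci (F : R -> R) (a : R) : continuous F -> leb.-integrable `[0, 1]
    (EFin \o (fun x => F x * trig_tr mu X W (- (t * x + a)) x)).
  move=> cF; apply: continuous_integrable_segment.
  under eq_fun do rewrite trig_tr_phase.
  by move=> x; apply: cvgM; [exact: cF|apply: cvgD; apply: cvgM;
    [exact: ccos|exact: cC|exact: csin|exact: cS]].
rewrite -RintegralD//; [|exact: ci|exact: ci].
rewrite /fejer band_trE; apply: eq_Rintegral => x _.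
rewrite !trig_tr_phase !addr0 cosDpihalf sinDpihalf /FC /FS.
have Dx : C x ^+ 2 + S x ^+ 2 != 0 := nz x.
by rewrite /D; field.
Qed.

(** Associativity of convolution: with h from [fejer_factorization],
f * fejer = f * (r * h) = (f * r) * h = 0, where r is the image of W mu under
X. *)
Lemma fejer_annihilated (f : R -> R) (B : R) :
  measurable_fun setT f -> (forall x, `|f x| <= B) ->
  (forall t, \int[mu]_w (W w * f (t - X w)) = 0) ->
  forall t, \int[leb]_v (fejer v * f (t - v)) = 0.
Proof.
move=> mf fB f0 t; have [h [mh [K K0 hK]] hfejer] := fejer_factorization.
have ih := integrable_decay mh hK.
have hb s : `|h s| <= K := decay_bounded K0 (hK s).
have /measurable_EFinP mW := measurable_int _ iW.
have B0 : 0 <= B := le_trans (normr_ge0 _) (fB 0).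
have mtv : measurable_fun setT (fun v : R => t - v) by exact: measurable_funB.
have mf1 : measurable_fun setT (fun v : R => f (t - v)) by exact: measurableT_comp.
have mh1 w : measurable_fun setT (fun v : R => h (v - X w)).
  by apply: measurableT_comp => //; exact: measurable_funB.
have ihf w : leb.-integrable setT (EFin \o (fun v => h (v - X w) * f (t - v))).
  exact: (integrable_Mbounded (integrable_shift (X w) ih) mf1 (fun v => fB (t - v))).
transitivity (\int[leb]_v \int[mu]_w (W w * (h (v - X w) * f (t - v)))).
  apply: eq_Rintegral => v _; rewrite -hfejer -RintegralZr//.
    by apply: eq_Rintegral => w _; rewrite mulrA.
  apply: (integrable_Mbounded iW _ (M := K)) => //.
  by apply: measurableT_comp => //; exact: measurable_funB.
(* The factor h (v - X w) couples the variables, so no product dominates the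
   integrand; its absolute integral is at most B |W|_1 |h|_1 by translation
   invariance. *)
rewrite -Rintegral_Fubini; last 4 first.
- apply: measurable_funM; first exact: measurableT_comp.
  apply: measurable_funM.
    apply: measurableT_comp => //; apply: measurable_funB => //.
    exact: measurableT_comp.
  exact: (@measurableT_comp _ _ _ _ _ _ _ _ snd mf1).
- move=> w; have := integrableZl measurableT (W w) (ihf w).
  by apply: eq_integrable => // v _ /=; rewrite EFinM.
- move=> v; apply: (integrable_Mbounded iW _ (M := K * B)) => //.
    apply: measurable_funM; last exact: measurable_cst.
    by apply: measurableT_comp => //; exact: measurable_funB.
  by move=> w; rewrite normrM ler_pM.
- have [_ fW] := integrableP _ _ _ iW; have [_ fh] := integrableP _ _ _ ih.
  have mnh : measurable_fun setT (fun v : R => `|(EFin \o h) v|%E).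
    by apply/measurable_EFinP; exact: measurableT_comp.
  have mnW : measurable_fun setT (fun v => `|(EFin \o W) v|%E).
    by apply/measurable_EFinP; exact: measurableT_comp.
  apply: (@le_lt_trans _ _ (\int[mu]_w
      (`|(EFin \o W) w| * (B%:E * \int[leb]_v `|(EFin \o h) v|)))%E).
    apply: ge0_le_integral => //.
    - by move=> w _; exact: integral_ge0.
    - have mm : measurable_fun [set: T * measurableTypeR R]
          (fun z => (`|W z.1 * (h (z.2 - X z.1) * f (t - z.2))|)%:E).
        apply/measurable_EFinP; apply: measurableT_comp => //.
        apply: measurable_funM; first exact: measurableT_comp.
        apply: measurable_funM.
          apply: measurableT_comp => //; apply: measurable_funB => //.
          exact: measurableT_comp.
        exact: (@measurableT_comp _ _ _ _ _ _ _ _ snd mf1).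
      by apply: (measurable_fun_fubini_tonelli_F _ mm) => z; rewrite lee_fin.
    - by apply: emeasurable_funM; [exact: mnW|exact: measurable_cst].
    - move=> w _.
      rewrite -(@ge0_integral_shift _ (fun v => `|(EFin \o h) v|)%E (X w))//.
      have mhs : measurable_fun setT (fun v : R => `|(EFin \o h) (v - X w)%R|%E).
        by apply/measurable_EFinP; exact: measurableT_comp.
      have mBh : measurable_fun setT (fun v : R => B%:E * `|(EFin \o h) (v - X w)%R|)%E.
        by apply: emeasurable_funM; [exact: measurable_cst|exact: mhs].
      rewrite -(ge0_integralZl leb measurableT mhs)//.
      rewrite -(ge0_integralZl leb measurableT mBh)//; last first.
        by move=> v _; rewrite -EFinM lee_fin mulr_ge0.
      apply: ge0_le_integral => //.
      + apply/measurable_EFinP; apply: measurableT_comp => //.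
        apply: measurable_funM; first exact: measurable_cst.
        by apply: measurable_funM; [exact: mh1|exact: mf1].
      + by apply: emeasurable_funM; [exact: measurable_cst|exact: mBh].
      + by move=> v _; rewrite lee_fin !normrM ler_wpM2l// mulrC ler_wpM2r.
  rewrite (ge0_integralZr mu measurableT mnW)//; last first.
    by apply: mule_ge0; rewrite ?lee_fin//; exact: integral_ge0.
  apply: lte_mul_pinfty => //; first exact: integral_ge0.
    by rewrite ge0_fin_numE//; exact: integral_ge0.
  exact: lte_mul_pinfty.
transitivity (\int[mu]_w (W w * \int[leb]_u (h u * f (t - X w - u)))).
  apply: eq_Rintegral => w _; rewrite RintegralZl//; congr (_ * _).
  have ihw : leb.-integrable setT (EFin \o (fun u => h u * f (t - X w - u))).
    apply: (integrable_Mbounded ih _ (M := B)) => //.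
    by apply: measurableT_comp => //; exact: measurable_funB.
  rewrite -(Rintegral_shift (X w) ihw).
  by apply: eq_Rintegral => v _; congr (_ * f _); ring.
rewrite (@Rintegral_Fubini_prod R _ _ T _ mu leb W h
  (fun w u => f (t - X w - u)) B)//; last first.
  apply: measurableT_comp => //; apply: measurable_funB => //.
  by apply: measurable_funB => //; exact: measurableT_comp.
rewrite (@eq_Rintegral _ _ _ _ _ (cst 0)); first by rewrite /Rintegral integral0.
move=> u _ /=; rewrite (_ : Rintegral _ _ _ = 0) ?mulr0// -(f0 (t - u)).
by apply: eq_Rintegral => w _; congr (_ * f _); ring.
Qed.

End factorization.

Section annihilator.
Context {R : realType} d (T : measurableType d).
Variables (mu : {sigma_finite_measure set T -> \bar R}) (X W : T -> R).
Hypotheses (mX : measurable_fun setT X) (iW : mu.-integrable setT (EFin \o W))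
  (iWXX : mu.-integrable setT (EFin \o (fun w => W w * X w * X w))).
Notation leb := (@lebesgue_measure R).
Hypothesis nz : forall theta,
  trig_tr mu X W 0 theta ^+ 2 + trig_tr mu X W (- (pi / 2)) theta ^+ 2 != 0.

(** Replacing X by X / l dilates the transform of W, which keeps it free of
zeros; applied to s |-> f (l s), the previous lemma gives Fejer kernels of every
scale. *)
Lemma fejer_annihilated_scaled (f : R -> R) (B : R) :
  measurable_fun setT f -> (forall x, `|f x| <= B) ->
  (forall t, \int[mu]_w (W w * f (t - X w)) = 0) ->
  forall x l, 0 < l -> \int[leb]_v (fejer v * f (x - l * v)) = 0.
Proof.
move=> mf fB f0 x l l0; have ln0 : l != 0 by rewrite gt_eqF.
have iWXX' : mu.-integrable setT (EFin \o (fun w => W w * (X w / l) * (X w / l))).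
  have := integrableZl measurableT (l^-1 ^+ 2) iWXX.
  apply: eq_integrable => // w _ /=; rewrite -EFinM; congr (_%:E); ring.
have trE phi theta : trig_tr mu (fun w => X w / l) W phi theta =
    trig_tr mu X W phi (theta / l).
  by apply: eq_Rintegral => w _; congr (_ * cos _); ring.
have mX' : measurable_fun setT (fun w => X w / l) by exact: measurable_funM.
have nz' theta : trig_tr mu (fun w => X w / l) W 0 theta ^+ 2 +
    trig_tr mu (fun w => X w / l) W (- (pi / 2)) theta ^+ 2 != 0.
  by rewrite !trE.
have := @fejer_annihilated R _ T mu (fun w => X w / l) W mX' iW iWXX' nz'
  (fun s => f (l * s)) B.
have ml : measurable_fun setT (fun s : R => f (l * s)).
  by apply: measurableT_comp => //; exact: measurable_funM.
move=> /(_ ml (fun s => fB (l * s))) H.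
rewrite -(H _ (x / l)); first by apply: eq_Rintegral => v _; congr (_ * f _); field.
move=> t; rewrite -[RHS](f0 (l * t)).
by apply: eq_Rintegral => w _; congr (_ * f _); field.
Qed.

(** As l tends to 0, the integral of fejer v * f (x - l v) tends to f x times the
integral of the Fejer kernel, by dominated convergence. *)
Lemma wiener_annihilator (f : R -> R) (B : R) :
  continuous f -> (forall x, `|f x| <= B) ->
  (forall t, \int[mu]_w (W w * f (t - X w)) = 0) -> forall x, f x = 0.
Proof.
move=> cf fB f0 x.
have mf : measurable_fun setT f by exact: continuous_measurable_fun.
pose G l v := fejer v * f (x - l * v).
have mxl l : measurable_fun setT (fun v : R => f (x - l * v)).
  by apply: measurableT_comp => //; apply: measurable_funB => //; exact: measurable_funM.
have iG l : leb.-integrable setT (EFin \o G l).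
  exact: (integrable_Mbounded integrable_fejer (mxl l) (fun v => fB _)).
have cG : {ae leb, forall v, setT v -> {in `](-1), 1[%classic : set R, continuous (G ^~ v)}}.
  apply: aeW => v _ l _; apply: cvgMl_tmp.
  apply: (@continuous_comp _ _ _ (fun l : R => x - l * v) f); last exact: cf.
  by apply: cvgB; [exact: cvg_cst|apply: cvgMr_tmp; exact: cvg_id].
have iB : leb.-integrable setT (EFin \o (fun v => fejer v * B)).
  by apply: (integrable_Mbounded integrable_fejer _ (M := `|B|)).
have GB l : (`](-1), 1[%classic : set R) l ->
    {ae leb, forall v, setT v -> `|G l v| <= fejer v * B}.
  move=> _; apply: aeW => v _; rewrite normrM ger0_norm ?fejer_ge0//.
  by rewrite ler_wpM2l// fejer_ge0.
have := @continuity_under_integral R _ _ leb G setT measurableT (-1) 1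
  (fun l _ => iG l) cG _ iB GB.
have I0 : (0 : R) \in `](-1), 1[%classic by rewrite inE/= in_itv/= ltrN10 ltr01.
move=> /(_ 0 I0) c0.
have c0r : (\int[leb]_v G l v) @[l --> 0^'+] --> \int[leb]_v G 0 v.
  exact: cvg_at_right_filter.
have z0r : (\int[leb]_v G l v) @[l --> 0^'+] --> (0 : R).
  apply: cvg_near_cst; near=> l.
  apply: (fejer_annihilated_scaled mf fB f0 x); near: l.
  exact: nbhs_right_gt.
have := cvg_unique (@Rhausdorff R) c0r z0r.
have -> : \int[leb]_v G 0 v = (\int[leb]_v fejer v) * f x.
  rewrite -RintegralZr//; last exact: integrable_fejer.
  by apply: eq_Rintegral => v _; rewrite /G mul0r subr0.
move=> /(_ _)/eqP; rewrite mulf_eq0 gt_eqF ?Rintegral_fejer_gt0//= => /eqP.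
Unshelve. all: by end_near. Qed.

End annihilator.

(** * Measures on the half-line and the measures nu_alpha *)

Section half_line.
Context {R : realType}.
Implicit Types m : {measure set (measurableTypeR R) -> \bar R}.
Notation D := (`]0%R, +oo[%classic : set R).

(** The masses near 0 and near infinity may be infinite, so the comparison is made
on the finite restrictions to ]1 / n, n[, where open rays form a generating
pi-system. *)
Lemma half_line_measure_unique m1 m2 :
  (forall p q : R, 0 < p -> p < q -> m1 `]p, q[%classic = m2 `]p, q[%classic) ->
  (forall p q : R, 0 < p -> p < q -> (m2 `]p, q[%classic < +oo)%E) ->
  eq_pos_measure m1 m2.
Proof.
move=> m12 m2oo B mB B0.
pose E n : set (measurableTypeR R) := `]n.+1%:R^-1, n.+1%:R[%classic.
have mE n : measurable (E n) by exact: measurable_itv.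
have m12' (p q : R) : 0 < p -> m1 `]p, q[%classic = m2 `]p, q[%classic.
  move=> p0; have [pq|qp] := ltP p q; first exact: m12.
  by rewrite set_itv_ge ?measure0// bnd_simp -leNgt.
have m2oo' (p q : R) : 0 < p -> (m2 `]p, q[%classic < +oo)%E.
  move=> p0; have [pq|qp] := ltP p q; first exact: m2oo.
  by rewrite set_itv_ge ?measure0 ?ltry// bnd_simp -leNgt.
have ray n (x : R) : `]-oo, x[%classic `&` E n =
    `]n.+1%:R^-1, (Num.min x n.+1%:R)[%classic.
  apply/seteqP; split=> z; rewrite /E /= !in_itv/= lt_min.
    by move=> [-> /andP[-> ->]].
  by move=> /andP[-> /andP[-> ->]].
have EB n : m1 (B `&` E n) = m2 (B `&` E n).
  have := @measure_unique _ R (measurableTypeR R) (@RGenInftyO.G R)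
    (fun k => `]-oo, k%:R[%classic) (@RGenInftyO.measurableE R).
  move=> /(_ _ _ _ (mrestr m1 (mE n)) (mrestr m2 (mE n))); apply => //.
  - move=> _ _ [x ->] [y ->]; exists (Num.min x y).
    apply/seteqP; split=> z; rewrite /= !in_itv/= lt_min.
      by move=> [-> ->].
    by move=> /andP[-> ->].
  - by move=> i; exists i%:R.
  - apply/seteqP; split=> // x _; exists (Num.truncn x).+1 => //=.
    by rewrite in_itv/= truncnS_gt.
  - move=> _ [x ->]; change (m1 (`]-oo, x[ `&` E n) = m2 (`]-oo, x[ `&` E n)).
    by rewrite ray m12'// invr_gt0.
  - move=> k; change (m1 (`]-oo, k%:R[ `&` E n) < +oo)%E.
    by rewrite ray m12' ?invr_gt0// m2oo'// invr_gt0.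
have ndE : nondecreasing_seq (fun n => B `&` E n).
  move=> a b ab; apply/subsetPset; apply: setIS => x; rewrite /E /= !in_itv/= => /andP[ax xa].
  apply/andP; split.
    by rewrite (le_lt_trans _ ax)// lef_pV2 ?posrE// ler_nat ltnS.
  by rewrite (lt_le_trans xa)// ler_nat ltnS.
have cup : \bigcup_n (B `&` E n) = B.
  rewrite -setI_bigcupr; apply: setIidl => x Bx.
  have x0 : 0 < x by have := B0 _ Bx; rewrite /= in_itv/= andbT.
  exists (maxn (Num.truncn x) (Num.truncn x^-1)) => //; rewrite /E /= in_itv/=.
  apply/andP; split.
    rewrite invf_plt ?posrE// (lt_le_trans (truncnS_gt _))// ler_nat ltnS.
    exact: leq_maxr.
  by rewrite (lt_le_trans (truncnS_gt _))// ler_nat ltnS; exact: leq_maxl.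
have mBE n : measurable (B `&` E n) by exact: (measurableI _ _ mB (mE n)).
have h m : m (B `&` E n) @[n --> \oo] --> m B.
  rewrite -{2}cup; apply: nondecreasing_cvg_mu => //.
  by rewrite cup.
have h1 := h m1; have := h m2.
rewrite (_ : (fun n => m2 _) = (fun n => m1 (B `&` E n))); last first.
  by apply/funext => n; rewrite EB.
by move=> h2; apply: (cvg_unique _ h1 h2).
Qed.

End half_line.

Section nu_alpha.
Context {R : realType}.
Variable alpha : R.
Notation D := (`]0%R, +oo[%classic : set R).
Notation nu := (nu_measure alpha).

Definition nu_primitive (x : R) : R :=
  if alpha == 0 then ln x else - Num.sg alpha * expR (- alpha * ln x).

Lemma nu_pdfE (x : R) : 0 < x -> nu_pdf alpha x =
  (if alpha == 0 then 1 else `|alpha| * expR (- alpha * ln x)) / x.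
Proof.
move=> x0; rewrite /nu_pdf; case: ifP => _; first by rewrite div1r.
rewrite /powR gt_eqF// -mulrA; congr (_ * _).
by rewrite -[X in _ / X]lnK ?posrE// -expRN -expRD; congr expR; ring.
Qed.

Lemma is_derive_nu_primitive (x : R) : 0 < x ->
  is_derive x 1 nu_primitive (nu_pdf alpha x).
Proof.
move=> x0; rewrite nu_pdfE// /nu_primitive; case: ifPn => a0.
  by rewrite div1r; exact: is_derive1_ln.
have dl := is_derive1_ln x0.
have Hl := derM (der_cst (- alpha) x) dl.
have He := @der_comp R expR (fun x => - alpha * ln x) x _ _ (is_derive_expR _) Hl.
apply: (is_derive_eq (derM (der_cst (- Num.sg alpha) x) He)).
by rewrite normrEsg; ring.
Qed.

Lemma nu_itv (p q : R) : 0 < p -> p < q ->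
  nu `]p, q[%classic = (nu_primitive q - nu_primitive p)%:E.
Proof.
move=> p0 pq.
rewrite /= /nu_fun /pos_density setIidl; last first.
  by move=> x /=; rewrite !in_itv/= andbT => /andP[/(lt_trans p0)].
pose g (x : R) := (if alpha == 0 then 1 else `|alpha| * expR (- alpha * ln x)) / x.
have c : {within `[p, q], continuous g}.
  apply: continuous_in_subspaceT => x /set_mem/=; rewrite in_itv/= => /andP[px _].
  have x0 : 0 < x by rewrite (lt_le_trans p0).
  apply: cvgM; last by apply: cvgV; [rewrite gt_eqF|exact: cvg_id].
  case: (alpha == 0); first exact: cvg_cst.
  apply: cvgMl_tmp; apply: (@continuous_comp _ _ _ (fun x => - alpha * ln x) expR).
    by apply: cvgMl_tmp; exact: continuous_ln.
  exact: continuous_expR.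
transitivity (\int[lebesgue_measure]_(x in `]p, q[) (g x)%:E)%E.
  apply: eq_integral => x /set_mem/=; rewrite in_itv/= => /andP[px _].
  by rewrite /= nu_pdfE// (lt_trans p0).
have dg x : x \in `[p, q] -> is_derive x 1 nu_primitive (g x).
  rewrite in_itv/= => /andP[px _]; have x0 := lt_le_trans p0 px.
  by rewrite /g -nu_pdfE//; exact: is_derive_nu_primitive.
rewrite -(is_derive_FTC2 pq dg c).
apply/esym; apply: (@integral_itv_bndoo R p q (EFin \o g) true false).
have := subspace_continuous_measurable_fun (measurable_itv `[p, q]) c.
move=> mc; apply/measurable_EFinP.
apply: measurable_funS mc => //.
exact: subset_itv_oo_cc.
Qed.

Lemma nu_itv_lty (p q : R) : 0 < p -> p < q -> (nu `]p, q[%classic < +oo)%E.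
Proof. by move=> p0 pq; rewrite nu_itv// ltry. Qed.

Lemma nu_itv_gt0 (p q : R) : 0 < p -> p < q -> (0 < nu `]p, q[%classic)%E.
Proof.
move=> p0 pq; rewrite nu_itv// lte_fin subr_gt0 /nu_primitive.
have pql : ln p < ln q by rewrite ltr_ln ?posrE// (lt_trans p0).
case: ifPn => [//|a0]; have [a_lt0|a_gt0|/eqP] := ltgtP alpha 0.
- by rewrite ltr0_sg// opprK !mul1r ltr_expR ltr_pM2l// oppr_gt0.
- by rewrite gtr0_sg// !mulN1r ltrN2 ltr_expR ltr_nM2l// oppr_lt0.
- by rewrite (negbTE a0).
Qed.

(** Homogeneity of nu_alpha, which need only be checked on intervals. *)
Lemma nu_dilation (y : R) : 0 < y ->
  eq_pos_measure (pushforward nu (fun x : R => y * x : measurableTypeR R))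
    (fun B => (expR (alpha * ln y))%:E * nu B)%E.
Proof.
move=> y0; have yge : 0 <= expR (alpha * ln y) := expR_ge0 _.
have my : measurable_fun [set: measurableTypeR R]
    ((fun x => y * x) : measurableTypeR R -> measurableTypeR R).
  exact: measurable_funM.
pose c : {nonneg R} := NngNum yge.
have := @half_line_measure_unique R (pushforward nu
  ((fun x : R => y * x) : measurableTypeR R -> measurableTypeR R)) (mscale c nu).
apply => p q p0 pq; last first.
  rewrite /= /mscale/=; apply: lte_mul_pinfty => //; exact: nu_itv_lty.
rewrite /= /pushforward /mscale/= (_ : _ @^-1` _ = `]p / y, q / y[%classic); last first.
  apply/seteqP; split=> x /=; rewrite !in_itv/= ltr_pdivrMr// ltr_pdivlMr//;
    by rewrite mulrC.
rewrite -[nu_fun alpha _]/(nu _) -[nu_fun alpha `]p, q[%classic]/(nu _).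
have q0 := lt_trans p0 pq.
rewrite !nu_itv ?divr_gt0 ?ltr_pM2r ?invr_gt0// -EFinM; congr (_%:E).
rewrite /nu_primitive !ln_div ?posrE//; case: ifPn => [/eqP ->|a0].
  by rewrite mul0r expR0 mul1r; ring.
have e u : expR (- alpha * (u - ln y)) = expR (alpha * ln y) * expR (- alpha * u).
  by rewrite -expRD; congr expR; ring.
by rewrite !e; ring.
Qed.

Lemma integral_nu_dilation (y : R) (G : R -> \bar R) : 0 < y ->
  measurable_fun setT G -> (forall x, 0 <= G x)%E ->
  (\int[nu]_(x in D) G (y * x)%R =
   (expR (alpha * ln y))%:E * \int[nu]_(x in D) G x)%E.
Proof.
move=> y0 mG G0; have yge : 0 <= expR (alpha * ln y) := expR_ge0 _.
have my : measurable_fun [set: measurableTypeR R]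
    ((fun x => y * x) : measurableTypeR R -> measurableTypeR R).
  exact: measurable_funM.
pose c : {nonneg R} := NngNum yge.
have mD : measurable D by exact: measurable_itv.
have DE : (fun x : R => y * x) @^-1` D = D.
  by apply/seteqP; split=> x /=; rewrite !in_itv/= !andbT pmulr_rgt0.
rewrite -[in LHS]DE.
rewrite -(@ge0_integral_pushforward _ _ (measurableTypeR R) (measurableTypeR R) R _ my nu D G)//.
- rewrite (eq_measure_integral (mscale c nu)); last first.
    by move=> A mA AD; rewrite /= /mscale/=; exact: nu_dilation.
  rewrite ge0_integral_mscale//; exact: measurable_funTS.
- exact: measurable_funTS.
Qed.

End nu_alpha.

(** * Multiplicative convolution and test functions *)

Section mconv_as_pushforward.
Context {R : realType}.
Notation D := (`]0%R, +oo[%classic : set R).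

Lemma pos_integralT (m : pos_measure R) (f : R -> \bar R) :
  measurable_fun setT f -> (forall x, 0 <= f x)%E ->
  (\int[m]_x f x = \int[m]_(x in D) f x)%E.
Proof.
move=> mf f0; rewrite (@ge0_negligible_integral _ _ _ m setT (`]-oo, 0%R]%classic))//.
- by rewrite setTD setCitvl.
- exact: pos_measure_npos.
Qed.

Variables (rho : pos_measure R).

Let mulR (z : measurableTypeR R * measurableTypeR R) : measurableTypeR R := z.1 * z.2.

Let mmulR : measurable_fun setT mulR.
Proof. by apply: measurable_funM. Qed.

(** The convolution is the law of a product; this is what allows it to be tested
against functions instead of sets. *)
Lemma mconvE (nu : pos_measure R) (A : set (measurableTypeR R)) :
  measurable A -> A `<=` D ->
  pushforward (rho \x nu)%E mulR A = mconv nu rho A.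
Proof.
move=> mA AD; rewrite /pushforward /= /product_measure1/=.
have mpre : measurable (mulR @^-1` A).
  by rewrite -[_ @^-1` _]setTI; exact: mmulR.
rewrite (@pos_integralT rho (nu \o xsection (mulR @^-1` A)))//; last first.
  exact: measurable_fun_xsection.
apply: eq_integral => y /set_mem/=; rewrite in_itv/= andbT => y0; congr (nu _).
apply/seteqP; split=> x.
  rewrite /xsection/= inE /mulR/= => Ayx; exists (y * x) => //.
  by rewrite mulrA mulVf ?mul1r// gt_eqF.
move=> /= [b Ab <-]; rewrite /xsection/= inE /mulR/=.
by rewrite mulrA mulfV ?mul1r// gt_eqF.
Qed.

Lemma integral_mconv (nu1 nu2 : pos_measure R) (G : R -> \bar R) :
  eq_pos_measure (mconv nu1 rho) (mconv nu2 rho) ->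
  measurable_fun setT G -> (forall x, 0 <= G x)%E ->
  (\int[rho]_(y in D) \int[nu1]_(x in D) G (y * x)%R =
   \int[rho]_(y in D) \int[nu2]_(x in D) G (y * x)%R)%E.
Proof.
move=> conv mG G0; have mD : measurable D by exact: measurable_itv.
have H (nu : pos_measure R) :
    (\int[rho]_(y in D) \int[nu]_(x in D) G (y * x)%R =
     \int[pushforward (rho \x nu) mulR]_(z in D) G z)%E.
  pose G' : measurableTypeR R -> \bar R := G \_ D.
  have mG' : measurable_fun setT G'.
    by apply/(measurable_restrictT G mD)/measurable_funTS.
  have G'0 z : (0 <= G' z)%E by rewrite /G' patchE; case: ifP.
  have mGm : measurable_fun setT (G' \o mulR) := measurableT_comp mG' mmulR.
  rewrite [RHS]integral_mkcond -/G'.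
  rewrite ge0_integral_pushforward// preimage_setT.
  rewrite (fubini_tonelli1 (G' \o mulR)); [|exact: mGm|by move=> z; exact: G'0].
  have mF := measurable_fun_fubini_tonelli_F (m2 := nu) (G' \o mulR) mGm
    (fun z => G'0 (mulR z)).
  have F0 y : (0 <= fubini_F nu (G' \o mulR) y)%E.
    by apply: integral_ge0 => x _; exact: G'0.
  rewrite [RHS](pos_integralT rho mF F0).
  apply: eq_integral => y /set_mem/=; rewrite in_itv/= andbT => y0.
  rewrite /fubini_F/= pos_integralT//; last first.
    have myx : measurable_fun setT (fun x : measurableTypeR R => mulR (y, x)).
      exact: (measurableT_comp mmulR (pair1_measurable y)).
    exact: (measurableT_comp mG' myx).
  apply: eq_integral => x /set_mem/=; rewrite in_itv/= andbT => x0.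
  by rewrite /G' /mulR/= patchE mem_set//= in_itv/= mulr_gt0.
rewrite !H; apply: eq_measure_integral => A mA AD.
transitivity (mconv nu1 rho A); first exact: mconvE.
by rewrite conv//; apply/esym; exact: mconvE.
Qed.

End mconv_as_pushforward.

Section twisted_convolution.
Context {R : realType}.
Variable alpha : R.
Notation D := (`]0%R, +oo[%classic : set R).
Implicit Types (m : pos_measure R) (phi : R -> R).

(** In the variable s = ln x this is the convolution of phi with the measure
exp(alpha s) m(ds). *)
Definition tconv m phi t : \bar R :=
  (\int[m]_(x in D) (expR (alpha * ln x) * phi (t - ln x))%:E)%E.

Lemma measurable_pow : measurable_fun setT (fun x : R => expR (alpha * ln x)).
Proof. by apply: measurableT_comp => //; apply: measurable_funM. Qed.

Lemma measurable_tconv_integrand phi t : measurable_fun setT phi ->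
  measurable_fun setT (fun x : R => expR (alpha * ln x) * phi (t - ln x)).
Proof.
move=> mphi; apply: measurable_funM; first exact: measurable_pow.
by apply: measurableT_comp => //; exact: measurable_funB.
Qed.

Lemma tconv_ge0 m phi t : (forall s, 0 <= phi s) -> (0 <= tconv m phi t)%E.
Proof.
by move=> phi0; apply: integral_ge0 => x _; rewrite lee_fin mulr_ge0 ?expR_ge0.
Qed.

Lemma le_tconv m phi psi t s :
  measurable_fun setT phi -> measurable_fun setT psi ->
  (forall r, 0 <= phi r) -> (forall r, phi (t - r) <= psi (s - r)) ->
  (tconv m phi t <= tconv m psi s)%E.
Proof.
move=> mphi mpsi phi0 phipsi; apply: ge0_le_integral => //.
- by move=> x _; rewrite lee_fin mulr_ge0 ?expR_ge0.
- by apply/measurable_EFinP/measurable_funTS; exact: measurable_tconv_integrand.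
- by apply/measurable_EFinP/measurable_funTS; exact: measurable_tconv_integrand.
- by move=> x _; rewrite lee_fin ler_wpM2l ?expR_ge0.
Qed.

Lemma measurable_tconv m phi : measurable_fun setT phi -> (forall s, 0 <= phi s) ->
  measurable_fun setT (tconv m phi).
Proof.
move=> mphi phi0.
pose f (z : R * measurableTypeR R) :=
  (expR (alpha * ln z.2) * phi (z.1 - ln z.2) * \1_D z.2)%:E.
have mf : measurable_fun setT f.
  apply/measurable_EFinP; apply: measurable_funM; last exact: measurableT_comp.
  apply: measurable_funM; first exact: (measurableT_comp measurable_pow).
  apply: measurableT_comp => //; apply: measurable_funB => //.
  exact: measurableT_comp.
have f0 z : (0 <= f z)%E by rewrite lee_fin !mulr_ge0 ?expR_ge0.
have := @measurable_fun_fubini_tonelli_F _ _ _ _ R m f mf f0.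
congr measurable_fun; apply/funext => t; rewrite /fubini_F /tconv.
rewrite [RHS]integral_mkcond; apply: eq_integral => x _.
by rewrite /f patchE indicE /=; case: (x \in _); rewrite ?mulr1 ?mulr0.
Qed.

Lemma tconvZl m phi t (k : R) : measurable_fun setT phi -> (forall s, 0 <= phi s) ->
  0 <= k -> (k%:E * tconv m phi t =
  \int[m]_(x in D) (k * (expR (alpha * ln x) * phi (t - ln x)))%:E)%E.
Proof.
move=> mphi phi0 k0; have mD : measurable D by exact: measurable_itv.
have mf : measurable_fun D (fun x => (expR (alpha * ln x) * phi (t - ln x))%:E).
  by apply/measurable_EFinP/measurable_funTS; exact: measurable_tconv_integrand.
rewrite -(ge0_integralZl m mD mf)//.
by move=> x _; rewrite lee_fin mulr_ge0 ?expR_ge0.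
Qed.

(** The test function z |-> z^alpha phi(t - ln z) splits along z = y x. *)
Lemma tconv_mconv (rho nu1 nu2 : pos_measure R) phi t :
  eq_pos_measure (mconv nu1 rho) (mconv nu2 rho) ->
  measurable_fun setT phi -> (forall s, 0 <= phi s) ->
  (\int[rho]_(y in D) ((expR (alpha * ln y))%:E * tconv nu1 phi (t - ln y)%R) =
   \int[rho]_(y in D) ((expR (alpha * ln y))%:E * tconv nu2 phi (t - ln y)%R))%E.
Proof.
move=> conv mphi phi0.
pose G z := (expR (alpha * ln z) * phi (t - ln z))%:E.
have mG : measurable_fun setT G.
  by apply/measurable_EFinP; exact: measurable_tconv_integrand.
have G0 z : (0 <= G z)%E by rewrite lee_fin mulr_ge0 ?expR_ge0.
have H (m : pos_measure R) :
    (\int[rho]_(y in D) ((expR (alpha * ln y))%:E * tconv m phi (t - ln y)%R) =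
     \int[rho]_(y in D) \int[m]_(x in D) G (y * x)%R)%E.
  apply: eq_integral => y /set_mem/=; rewrite in_itv/= andbT => y0.
  rewrite tconvZl ?expR_ge0//.
  apply: eq_integral => x /set_mem/=; rewrite in_itv/= andbT => x0.
  rewrite /G lnM ?posrE// mulrDr expRD -mulrA; congr (_ * (_ * phi _))%:E.
  by ring.
by rewrite !H; exact: integral_mconv.
Qed.

(** Dilating by exp t moves the argument from 0 to t and, by homogeneity, changes
nothing else. *)
Lemma tconv_nu phi t : measurable_fun setT phi -> (forall s, 0 <= phi s) ->
  tconv (nu_measure alpha) phi t = tconv (nu_measure alpha) phi 0.
Proof.
move=> mphi phi0.
pose G x := (expR (alpha * ln x) * phi (t - ln x))%:E.
have mG : measurable_fun setT G.
  by apply/measurable_EFinP; exact: measurable_tconv_integrand.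
have G0 x : (0 <= G x)%E by rewrite lee_fin mulr_ge0 ?expR_ge0.
have H := integral_nu_dilation alpha (expR_gt0 t) mG G0.
rewrite expRK in H.
have : ((expR (alpha * t))%:E * tconv (nu_measure alpha) phi 0 =
    (expR (alpha * t))%:E * tconv (nu_measure alpha) phi t)%E.
  rewrite -/(tconv _ _ _) in H; rewrite -H tconvZl ?expR_ge0//.
  apply: eq_integral => x /set_mem/=; rewrite in_itv/= andbT => x0.
  rewrite /G lnM ?posrE ?expR_gt0// expRK mulrDr expRD -mulrA.
  by congr (_ * (_ * phi _))%:E; ring.
move=> /(congr1 (mule (expR (alpha * t))^-1%:E)).
by rewrite !muleA -EFinM mulVf ?gt_eqF ?expR_gt0// !mul1e.
Qed.

Lemma tconv_nu_lty L :
  (tconv (nu_measure alpha) (\1_(`[- L, L]%classic : set R)%R) 0%R < +oo)%E.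
Proof.
pose I := `](expR (- L - 1)), (expR (L + 1))[%classic : set R.
have mI : measurable I by exact: measurable_itv.
apply: (@le_lt_trans _ _ (\int[nu_measure alpha]_(x in D)
    ((expR (`|alpha| * L))%:E * (\1_I x)%:E))%E).
  apply: ge0_le_integral => //.
  - by apply/measurable_EFinP/measurable_funTS; exact: measurable_tconv_integrand.
  - by apply: emeasurable_funM => //; apply/measurable_EFinP/measurable_funTS.
  - move=> x /=; rewrite in_itv/= andbT => x0.
    rewrite -EFinM lee_fin !indicE; have [|_] := boolP (0 - ln x \in _); last first.
      by rewrite mulr0 mulr_ge0 ?expR_ge0.
    rewrite inE/= in_itv/= sub0r => /andP[lo hi].
    rewrite mem_set; last first.
      rewrite /I/= in_itv/= -[x]lnK ?posrE// !ltr_expR; apply/andP; split; lra.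
    rewrite !mulr1 ler_expR (le_trans (ler_norm _))// normrM ler_wpM2l//.
    by rewrite ler_norml; apply/andP; split; lra.
have mD : measurable D by exact: measurable_itv.
have m1 : measurable_fun D (fun x => (\1_I x)%:E : \bar R).
  by apply/measurable_EFinP/measurable_funTS.
rewrite (@ge0_integralZl _ (measurableTypeR R) R (nu_measure alpha) D mD
  (fun x => (\1_I x)%:E) m1) ?lee_fin ?expR_ge0//.
rewrite integral_indic// lte_mul_pinfty ?lee_fin ?expR_ge0//.
apply: (@le_lt_trans _ _ (nu_measure alpha I)).
  by apply: le_measure; rewrite ?inE//; exact: measurableI.
have [L1|L1] := ltP (- L - 1) (L + 1).
  by apply: nu_itv_lty; rewrite ?expR_gt0 ?ltr_expR.
by rewrite /I set_itv_ge ?measure0 ?ltry// bnd_simp -leNgt ler_expR.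
Qed.

End twisted_convolution.

(** * Cancellation *)

Section boundedness.
Context {R : realType}.
Variables (alpha : R) (rho nu : pos_measure R).
Notation D := (`]0%R, +oo[%classic : set R).
Notation nua := (nu_measure alpha).
Let mD : measurable D. Proof. exact: measurable_itv. Qed.

Lemma compact_mass : ~ eq_pos_measure rho mzero ->
  exists K : R, (0 < rho `[expR (- K), expR K]%classic)%E.
Proof.
move=> rho0; apply: contra_notP rho0 => /forallNP rhoK B mB BD.
have negl n : rho.-negligible (`[expR (- n%:R), expR n%:R]%classic : set R).
  exists `[expR (- n%:R), expR n%:R]%classic; split => //.
  by apply/eqP; rewrite -measure_le0 leNgt; apply/negP; exact: rhoK.
rewrite /mzero; apply: measure_negligible => //.
apply: negligibleS (negligible_bigcup negl) => x Bx.
have x0 : 0 < x by have := BD _ Bx; rewrite /= in_itv/= andbT.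
pose N := (Num.truncn `|ln x|).+1.
have : `|ln x| <= N%:R by exact: ltW (truncnS_gt _).
rewrite ler_norml => /andP[lo hi]; exists N => //.
by rewrite /= in_itv/= -[x]lnK ?posrE// !ler_expR; apply/andP.
Qed.

Hypothesis rho_neq0 : ~ eq_pos_measure rho mzero.
Hypothesis conv : eq_pos_measure (mconv nu rho) (mconv nua rho).
Hypothesis mass : (\int[rho]_(y in D) (expR (alpha * ln y))%:E < +oo)%E.

Let mass_ge0 : (0 <= \int[rho]_(y in D) (expR (alpha * ln y))%:E)%E.
Proof. by apply: integral_ge0 => x _; rewrite lee_fin expR_ge0. Qed.

Let mpow : measurable_fun D (fun y => (expR (alpha * ln y))%:E : \bar R).
Proof. by apply/measurable_EFinP/measurable_funTS; exact: measurable_pow. Qed.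

Lemma tconv_mass (phi : R -> R) t : measurable_fun setT phi -> (forall s, 0 <= phi s) ->
  (\int[rho]_(y in D) ((expR (alpha * ln y))%:E * tconv alpha nu phi (t - ln y)%R) =
   (\int[rho]_(y in D) (expR (alpha * ln y))%:E) * tconv alpha nua phi 0)%E.
Proof.
move=> mphi phi0; rewrite (@tconv_mconv R alpha rho nu nua phi t conv)//.
under eq_integral => y _ do rewrite tconv_nu//.
rewrite (@ge0_integralZr _ (measurableTypeR R) R rho D mD
  (fun y => (expR (alpha * ln y))%:E) mpow)//.
- exact: tconv_ge0.
Qed.

(** For |ln y| <= K the window of half-width L + K centred at t - ln y contains
the one of half-width L centred at t.  Integrating over such y bounds
tconv(t) times a positive mass by a value of the convolution that does not
depend on t. *)
Lemma tconv_bounded L : exists2 B : R, 0 <= B &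
  forall t, (tconv alpha nu (\1_(`[- L, L]%classic : set R))%R t <= B%:E)%E.
Proof.
have [K HK] := compact_mass rho_neq0.
pose E : set R := `[expR (- K), expR K]%classic.
have mE : measurable E by exact: measurable_itv.
have ED : E `<=` D.
  move=> x; rewrite /E /= !in_itv/= andbT => /andP[+ _].
  by apply: lt_le_trans; exact: expR_gt0.
pose c0 := (\int[rho]_(y in E) (expR (alpha * ln y))%:E)%E.
have c0_gt0 : (0 < c0)%E.
  have : (0 < \int[rho]_(y in E) (expR (- (`|alpha| * K)))%:E)%E.
    by rewrite integral_cst// mule_gt0// lte_fin expR_gt0.
  move=> /lt_le_trans; apply; apply: ge0_le_integral => //.
  - by apply/measurable_EFinP/measurable_funTS; exact: measurable_pow.
  - move=> x; rewrite /E /= in_itv/= => xE; have /andP[lo hi] := xE.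
    have x0 : 0 < x by apply: lt_le_trans lo; exact: expR_gt0.
    move: xE; rewrite -[x]lnK ?posrE// !ler_expR => lnx.
    rewrite lee_fin ler_expR lerNl expRK -mulrN (le_trans (ler_norm _))// normrM.
    by rewrite ler_wpM2l// normrN ler_norml.
have c0_fin : (c0 < +oo)%E.
  apply: le_lt_trans mass; apply: ge0_subset_integral => //.
pose psi : R -> R := \1_(`[- (L + K), L + K]%classic : set R).
have V0 := tconv_nu_lty alpha (L + K).
have psi0 s : 0 <= psi s by rewrite /psi indicE ler0n.
have mpsi : measurable_fun setT psi by exact: measurable_indic.
pose V := tconv alpha nua psi 0.
have Vge0 : (0 <= V)%E by exact: tconv_ge0.
pose m := (\int[rho]_(y in D) (expR (alpha * ln y))%:E)%E.
have mVfin : (m * V)%E \is a fin_num.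
  by rewrite fin_numM// ge0_fin_numE.
have c0fin : c0 \is a fin_num by rewrite ge0_fin_numE// ltW.
have c0r : 0 < fine c0 by rewrite fine_gt0// c0_gt0.
exists (fine (m * V) / fine c0).
  by rewrite divr_ge0// ?fine_ge0// ?mule_ge0// ltW.
move=> t; rewrite EFinM lee_pdivlMr// !fineK//.
rewrite -(tconv_mass t)//.
set u := tconv _ _ _ t.
have mpE : measurable_fun E (fun y => (expR (alpha * ln y))%:E : \bar R).
  by apply/measurable_EFinP/measurable_funTS; exact: measurable_pow.
have u0 : (0 <= u)%E by exact: tconv_ge0.
have c0u : (u * c0 = \int[rho]_(y in E) ((expR (alpha * ln y))%:E * u))%E.
  rewrite muleC; apply/esym.
  apply: (@ge0_integralZr _ (measurableTypeR R) R rho E mE _ mpE u _ u0) => y _.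
  by rewrite lee_fin expR_ge0.
rewrite c0u.
have mint : measurable_fun D
    (fun y => (expR (alpha * ln y))%:E * tconv alpha nu psi (t - ln y)%R)%E.
  apply: emeasurable_funM => //; apply: measurable_funTS.
  apply: (@measurableT_comp _ _ _ _ _ _ (tconv alpha nu psi)).
    exact: measurable_tconv.
  exact: measurable_funB.
have int0 y : D y ->
    (0 <= (expR (alpha * ln y))%:E * tconv alpha nu psi (t - ln y)%R)%E.
  by move=> _; rewrite mule_ge0 ?lee_fin ?expR_ge0// tconv_ge0.
apply: (@le_trans _ _ (\int[rho]_(y in E)
    ((expR (alpha * ln y))%:E * tconv alpha nu psi (t - ln y)%R))%E); last first.
  exact: ge0_subset_integral.
apply: ge0_le_integral => //.
- by move=> y _; rewrite mule_ge0 ?lee_fin ?expR_ge0.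
- by apply: emeasurable_funM.
- exact: measurable_funS mint.
move=> y Ey; apply: lee_wpmul2l; first by rewrite lee_fin expR_ge0.
apply: le_tconv => // r; rewrite /psi !indicE.
have [|//] := boolP (t - r \in _); rewrite inE/= in_itv/= => /andP[lo hi].
have x0 : 0 < y by have := ED _ Ey; rewrite /= in_itv/= andbT.
move: Ey; rewrite /E /= in_itv/= -[y]lnK ?posrE// !ler_expR expRK => /andP[l1 l2].
by rewrite mem_set//= in_itv/=; apply/andP; split; lra.
Qed.

End boundedness.

Section test_functions.
Context {R : realType}.
Variables (alpha : R) (rho nu : pos_measure R).
Notation D := (`]0%R, +oo[%classic : set R).
Notation nua := (nu_measure alpha).
Let mD : measurable D. Proof. exact: measurable_itv. Qed.

Definition window (L : R) : R -> R := \1_(`[- L, L]%classic : set R).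

Lemma measurable_window L : measurable_fun setT (window L).
Proof. exact: measurable_indic. Qed.

Lemma window_ge0 L s : 0 <= window L s.
Proof. by rewrite /window indicE ler0n. Qed.

Lemma tconv_le_window (m : pos_measure R) (phi : R -> R) (M L t : R) :
  measurable_fun setT phi -> 0 <= M ->
  (forall s, 0 <= phi s) -> (forall s, phi s <= M * window L s) ->
  (tconv alpha m phi t <= M%:E * tconv alpha m (window L) t)%E.
Proof.
move=> mphi M0 phi0 phiM; have mw := measurable_window L.
rewrite (tconvZl alpha m t mw (window_ge0 L) M0).
have := @le_tconv R alpha m phi (fun s => M * window L s) t t mphi.
move=> /(_ (measurable_funM (measurable_cst _) mw) phi0 (fun r => phiM (t - r))).
move=> /le_trans; apply; rewrite le_eqVlt; apply/orP; left; apply/eqP.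
by apply: eq_integral => x _; congr (_%:E); ring.
Qed.

Lemma tconv_integrable (m : pos_measure R) (phi : R -> R) t :
  measurable_fun setT phi -> (forall s, 0 <= phi s) ->
  (tconv alpha m phi t < +oo)%E ->
  m.-integrable D (EFin \o (fun x => expR (alpha * ln x) * phi (t - ln x))).
Proof.
move=> mphi phi0 fin; apply/integrableP; split.
  by apply/measurable_EFinP/measurable_funTS; exact: measurable_tconv_integrand.
apply: le_lt_trans fin; rewrite le_eqVlt; apply/orP; left; apply/eqP.
by apply: eq_integral => x _; rewrite /= ger0_norm// mulr_ge0 ?expR_ge0.
Qed.

Hypothesis rho_neq0 : ~ eq_pos_measure rho mzero.
Hypothesis conv : eq_pos_measure (mconv nu rho) (mconv nua rho).

Let W := (fun y => expR (alpha * ln y)) \_ D.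

Hypothesis iW : rho.-integrable setT (EFin \o W).
Hypothesis iWXX : rho.-integrable setT (EFin \o (fun y => W y * ln y * ln y)).
Hypothesis nz : forall theta,
  trig_tr rho (@ln R) W 0 theta ^+ 2 + trig_tr rho (@ln R) W (- (pi / 2)) theta ^+ 2 != 0.

Lemma Rintegral_pow (c : R -> R) : \int[rho]_y (W y * c y) =
  \int[rho]_(y in D) (expR (alpha * ln y) * c y).
Proof.
rewrite [RHS]Rintegral_mkcond; apply: eq_Rintegral => y _.
by rewrite /W !patchE; case: ifP; rewrite ?mul0r.
Qed.

Let mass : (\int[rho]_(y in D) (expR (alpha * ln y))%:E < +oo)%E.
Proof.
have [_] := integrableP _ _ _ iW; apply: le_lt_trans.
rewrite le_eqVlt; apply/orP; left; apply/eqP.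
rewrite [LHS]integral_mkcond; apply: eq_integral => y _.
rewrite /= /W !patchE; case: ifP => _; last by rewrite normr0.
by rewrite ger0_norm ?expR_ge0.
Qed.

Variables (phi : R -> R) (M L : R).
Hypotheses (M0 : 0 <= M) (cphi : continuous phi) (phi0 : forall s, 0 <= phi s)
  (phiM : forall s, phi s <= M * window L s).

Let mphi : measurable_fun setT phi.
Proof. exact: continuous_measurable_fun. Qed.

(** The difference of the two sides is bounded, continuous and annihilated by
convolution with the weight, hence 0. *)
Lemma tconv_cancel t : tconv alpha nu phi t = tconv alpha nua phi t.
Proof.
have [B B0 HB] := tconv_bounded rho_neq0 conv mass L.
have [B' B'0 HB'] := tconv_bounded rho_neq0 conv mass (L + 1).
have ub s : (tconv alpha nu phi s <= (M * B)%:E)%E.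
  rewrite (le_trans (tconv_le_window _ _ mphi M0 phi0 phiM))//.
  by rewrite EFinM lee_wpmul2l ?lee_fin// HB.
have ufin s : tconv alpha nu phi s \is a fin_num.
  by rewrite ge0_fin_numE ?tconv_ge0// (le_lt_trans (ub s))// ltry.
have vfin : tconv alpha nua phi 0 \is a fin_num.
  rewrite ge0_fin_numE ?tconv_ge0//.
  apply: (le_lt_trans (tconv_le_window _ _ mphi M0 phi0 phiM)).
  by rewrite lte_mul_pinfty ?lee_fin//; exact: tconv_nu_lty.
pose u s := fine (tconv alpha nu phi s).
pose v := fine (tconv alpha nua phi 0).
have u0 s : 0 <= u s by rewrite fine_ge0 ?tconv_ge0.
have uMB s : u s <= M * B by rewrite -lee_fin fineK.
have cu : continuous u.
  move=> t0; pose psi s := M * window (L + 1) s.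
  have mpsi : measurable_fun setT psi.
    by apply: measurable_funM => //; exact: measurable_window.
  have psi0 s : 0 <= psi s by rewrite mulr_ge0// window_ge0.
  have psifin : (tconv alpha nu psi t0 < +oo)%E.
    apply: (le_lt_trans (tconv_le_window _ _ mpsi M0 psi0 (fun s => lexx _))).
    rewrite lte_mul_pinfty ?lee_fin//.
    by apply: (le_lt_trans (HB' _)); exact: ltry.
  have It0 : t0 \in `]t0 - 1, t0 + 1[%classic.
    by rewrite inE/= in_itv/=; apply/andP; split; lra.
  (* For |s - t0| < 1 the window around s lies in the one of half-width L + 1
     around t0. *)
  apply: (@continuity_under_integral R _ _ nu
    (fun s x => expR (alpha * ln x) * phi (s - ln x)) D mD (t0 - 1) (t0 + 1) _ _
    (fun x => expR (alpha * ln x) * psi (t0 - ln x)) _ _ t0 It0).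
  - move=> s _; apply: tconv_integrable => //.
    by apply: (le_lt_trans (ub s)); exact: ltry.
  - apply: aeW => x _ s _; apply: cvgMl_tmp.
    apply: (@continuous_comp _ _ _ (fun s : R => s - ln x) phi); last exact: cphi.
    by apply: cvgB; [exact: cvg_id|exact: cvg_cst].
  - exact: tconv_integrable.
  - move=> s; rewrite /= in_itv/= => /andP[s1 s2]; apply: aeW => x _.
    rewrite ger0_norm ?mulr_ge0 ?expR_ge0// ler_wpM2l ?expR_ge0//.
    rewrite (le_trans (phiM _))// /psi ler_wpM2l// /window !indicE.
    have [|//] := boolP (s - ln x \in _); rewrite inE/= in_itv/= => /andP[lo hi].
    by rewrite mem_set//= in_itv/=; apply/andP; split; lra.
have mu : measurable_fun setT u by exact: continuous_measurable_fun.
have ann s : \int[rho]_y (W y * (u (s - ln y) - v)) = 0.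
  have mus : measurable_fun setT (fun y => u (s - ln y)).
    by apply: measurableT_comp => //; exact: measurable_funB.
  under eq_Rintegral => y _ do rewrite mulrBr.
  rewrite RintegralB//; last 2 first.
  - apply: (integrable_Mbounded iW mus (M := M * B)) => y.
    by rewrite ger0_norm.
  - by apply: (integrable_Mbounded iW (measurable_cst v) (M := `|v|)).
  apply/eqP; rewrite subr_eq0; apply/eqP; rewrite !Rintegral_pow.
  rewrite /Rintegral; congr fine.
  transitivity (\int[rho]_(y in D)
      ((expR (alpha * ln y))%:E * tconv alpha nu phi (s - ln y)%R))%E.
    by apply: eq_integral => y _; rewrite EFinM /u fineK.
  rewrite (tconv_mconv alpha _ conv)//; apply: eq_integral => y _.
  by rewrite EFinM /v fineK// tconv_nu.
have fb x : `|u x - v| <= M * B + `|v|.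
  by rewrite (le_trans (ler_normB _ _))// lerD2r ger0_norm.
have cf : continuous (fun x => u x - v).
  by move=> x; apply: cvgB; [exact: cu|exact: cvg_cst].
have := @wiener_annihilator R _ _ rho (@ln R) W (@measurable_ln R) iW iWXX nz
  (fun x => u x - v) _ cf fb ann t.
move=> /= /eqP; rewrite subr_eq0 => /eqP uv.
by rewrite [RHS]tconv_nu// -[RHS]fineK// -/v -uv fineK.
Qed.

End test_functions.

Section trapezoid.
Context {R : realType}.
Variables (a b : R).
Notation D := (`]0%R, +oo[%classic : set R).

(** Continuous functions increasing to the indicator of ]a, b[. *)
Definition trapezoid (k : nat) (r : R) : R :=
  Num.min 1 (k%:R * Num.max 0 (Num.min (r - a) (b - r))).

Lemma trapezoid_ge0 k r : 0 <= trapezoid k r.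
Proof. by rewrite /trapezoid le_min ler01 mulr_ge0// le_max lexx. Qed.

Lemma trapezoid_le1 k r : trapezoid k r <= 1.
Proof. by rewrite /trapezoid ge_min lexx. Qed.

Lemma trapezoid_out k r : r \notin `]a, b[ -> trapezoid k r = 0.
Proof.
rewrite in_itv/= negb_and -!leNgt => rab.
rewrite /trapezoid (_ : Num.max _ _ = 0) ?mulr0; last first.
  by apply/max_idPl; rewrite ge_min !subr_le0.
by apply/min_idPr.
Qed.

Lemma nondecreasing_trapezoid r : nondecreasing_seq (trapezoid ^~ r).
Proof.
move=> m n mn; rewrite /trapezoid le_min ge_min lexx/= ge_min.
by rewrite ler_wpM2r ?orbT// ?ler_nat// le_max lexx.
Qed.

Lemma continuous_trapezoid k : continuous (trapezoid k).
Proof.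
have cmin (f g : R -> R) : continuous f -> continuous g ->
    continuous (fun x => Num.min (f x) (g x)).
  by move=> cf cg x; apply: continuous_min; [exact: cf|exact: cg].
have cmax (f g : R -> R) : continuous f -> continuous g ->
    continuous (fun x => Num.max (f x) (g x)).
  by move=> cf cg x; apply: continuous_max; [exact: cf|exact: cg].
apply: (cmin _ _); first by move=> x; exact: cvg_cst.
have cm : continuous (fun r : R => Num.max 0 (Num.min (r - a) (b - r))).
  apply: (cmax _ _); first by move=> x; exact: cvg_cst.
  apply: (cmin _ _) => x; first by apply: cvgB; [exact: cvg_id|exact: cvg_cst].
  by apply: cvgB; [exact: cvg_cst|exact: cvg_id].
by move=> x; apply: cvgMl_tmp; exact: cm.
Qed.

Lemma cvg_trapezoid r : (trapezoid k r)%:E @[k --> \oo] --> (\1_(`]a, b[%classic : set R) r)%:E.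
Proof.
apply: cvg_near_cst; have [rab|rab] := boolP (r \in `]a, b[); last first.
  apply: nearW => k; rewrite trapezoid_out// indicE memNset//.
  by move=> /= rab'; move/negP: rab.
rewrite indicE mem_set//; move: rab; rewrite in_itv/= => /andP[ar rb].
pose e := Num.min (r - a) (b - r).
have e0 : 0 < e by rewrite lt_min !subr_gt0 ar.
near=> k; congr (_%:E); apply/min_idPl.
rewrite -/e (_ : Num.max 0 e = e); last by apply/max_idPr; exact: ltW.
rewrite -ler_pdivrMr// div1r; near: k; exact: nbhs_infty_ger.
Unshelve. all: by end_near. Qed.

End trapezoid.

Section cancellation.
Context {R : realType}.
Variables (alpha : R) (rho nu : pos_measure R).
Notation D := (`]0%R, +oo[%classic : set R).
Notation nua := (nu_measure alpha).

Lemma cvg_integral_trapezoid (m : pos_measure R) (p q : R) : 0 < p -> 0 < q ->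
  (\int[m]_(x in D) (trapezoid (ln p) (ln q) k (ln x))%:E @[k --> \oo] -->
   m `]p, q[%classic)%E.
Proof.
move=> p0 q0; have mD : measurable D by exact: measurable_itv.
have mt k : measurable_fun setT (fun x => trapezoid (ln p) (ln q) k (ln x)).
  apply: (@measurableT_comp _ _ _ _ _ _ (trapezoid (ln p) (ln q) k)) => //.
  by apply: continuous_measurable_fun; exact: continuous_trapezoid.
have lim0 x : D x -> (\1_(`]p, q[%classic : set R) x)%:E =
    limn (fun k => (trapezoid (ln p) (ln q) k (ln x))%:E).
  rewrite /= in_itv/= andbT => x0; apply/esym/cvg_lim => //.
  rewrite (_ : \1__ x = \1_(`]ln p, ln q[%classic : set R) (ln x)); first exact: cvg_trapezoid.
  rewrite !indicE; congr ((nat_of_bool _)%:R); apply/idP/idP; rewrite !inE/= !in_itv/=.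
    by rewrite !ltr_ln ?posrE.
  by rewrite !ltr_ln ?posrE.
have -> : m `]p, q[%classic =
    (\int[m]_(x in D) limn (fun k => (trapezoid (ln p) (ln q) k (ln x))%:E))%E.
  under [RHS]eq_integral => x xD do rewrite -(lim0 _ (set_mem xD)).
  rewrite integral_indic//; congr (m _); apply/esym/setIidl => x /=.
  by rewrite !in_itv/= andbT => /andP[px _]; exact: lt_trans px.
apply: cvg_monotone_convergence => //.
- by move=> k; apply/measurable_EFinP/measurable_funTS; exact: mt.
- by move=> k x _; rewrite lee_fin trapezoid_ge0.
- by move=> x _ k l kl; rewrite lee_fin; exact: nondecreasing_trapezoid.
Qed.

Hypothesis rho_neq0 : ~ eq_pos_measure rho mzero.
Hypothesis conv : eq_pos_measure (mconv nu rho) (mconv nua rho).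
Let W := (fun y => expR (alpha * ln y)) \_ D.
Hypothesis iW : rho.-integrable setT (EFin \o W).
Hypothesis iWXX : rho.-integrable setT (EFin \o (fun y => W y * ln y * ln y)).
Hypothesis nz : forall theta,
  trig_tr rho (@ln R) W 0 theta ^+ 2 +
  trig_tr rho (@ln R) W (- (pi / 2)) theta ^+ 2 != 0.

(** The test function exp(alpha s) trapezoid(- s) compensates the power in
[tconv], so that [tconv_cancel] compares the integrals of the trapezoids
themselves, which increase to the masses of ]p, q[. *)
Lemma cancel_nu : eq_pos_measure nu nua.
Proof.
apply: half_line_measure_unique => p q p0 pq; last exact: nu_itv_lty.
have q0 := lt_trans p0 pq.
have h1 := @cvg_integral_trapezoid nu p q p0 q0.
have h2 := @cvg_integral_trapezoid nua p q p0 q0.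
suff e k : (\int[nu]_(x in D) (trapezoid (ln p) (ln q) k (ln x))%:E =
            \int[nua]_(x in D) (trapezoid (ln p) (ln q) k (ln x))%:E)%E.
  move: h1; rewrite (_ : (fun k => _) = (fun k =>
    \int[nua]_(x in D) (trapezoid (ln p) (ln q) k (ln x))%:E)%E); last first.
    by apply/funext => k; exact: e.
  by move=> h1; apply: (cvg_unique _ h1 h2).
pose phi (s : R) := expR (alpha * s) * trapezoid (ln p) (ln q) k (- s).
pose L := `|ln p| + `|ln q|.
have mE (m : pos_measure R) :
    (\int[m]_(x in D) (trapezoid (ln p) (ln q) k (ln x))%:E = tconv alpha m phi 0)%E.
  apply: eq_integral => x _; congr (_%:E).
  by rewrite /phi sub0r opprK mulrA -expRD mulrN subrr expR0 mul1r.
rewrite !mE; apply: (@tconv_cancel R alpha rho nu rho_neq0 conv iW iWXX nz phi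
  (expR (`|alpha| * L)) L).
- exact: expR_ge0.
- move=> s; apply: cvgM.
    apply: (@continuous_comp _ _ _ (fun s : R => alpha * s) expR).
      by apply: cvgMl_tmp; exact: cvg_id.
    exact: continuous_expR.
  apply: (@continuous_comp _ _ _ (fun s : R => - s) (trapezoid (ln p) (ln q) k)).
    by apply: cvgN; exact: cvg_id.
  exact: continuous_trapezoid.
- by move=> s; rewrite mulr_ge0 ?expR_ge0// trapezoid_ge0.
- move=> s; rewrite /phi.
  have [sab|sab] := boolP (- s \in `]ln p, ln q[); last first.
    by rewrite trapezoid_out// mulr0 mulr_ge0 ?expR_ge0// window_ge0.
  have sL : `|s| <= L.
    move: sab; rewrite in_itv/= => /andP[lo hi]; rewrite ler_norml /L.
    have := ler_norm (ln q); have := lerNnormlW (lexx `|ln p|).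
    have := normr_ge0 (ln p); have := normr_ge0 (ln q).
    by move=> *; apply/andP; split; lra.
  rewrite /window indicE mem_set ?mulr1; last first.
    by rewrite /= in_itv/= -ler_norml.
  rewrite -[leRHS]mulr1 ler_pM ?expR_ge0 ?trapezoid_ge0 ?trapezoid_le1//.
  by rewrite ler_expR (le_trans (ler_norm _))// normrM ler_wpM2l.
Qed.

End cancellation.

(** * Measures with a bounded density and their convolutions *)

Section density.
Context {R : realType}.
Notation D := (`]0%R, +oo[%classic : set R).
Variables (m : pos_measure R) (g : R -> R) (K : R).
Hypotheses (mg : measurable_fun setT g) (g0 : forall x, 0 <= g x)
  (gK : forall x, g x <= K).

Definition density_measure : set (measurableTypeR R) -> \bar R := pos_density m g.

Let mgE (A : set (measurableTypeR R)) : measurable_fun A (fun x => (g x)%:E : \bar R).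
Proof. exact/measurable_EFinP/measurable_funTS. Qed.

Let density0 : density_measure set0 = 0%E.
Proof. by rewrite /density_measure /pos_density set0I integral_set0. Qed.

Let density_ge0 B : (0 <= density_measure B)%E.
Proof. by apply: integral_ge0 => x _; rewrite lee_fin. Qed.

Let density_sigma_additive : semi_sigma_additive density_measure.
Proof.
move=> /= F mF tF mUF; rewrite /density_measure /pos_density; apply: cvg_toP.
  apply: ereal_nondecreasing_is_cvgn => k n kn.
  by apply: lee_sum_nneg_natr => // i _ _; exact: density_ge0.
rewrite setI_bigcupl ge0_integral_bigcup//=.
- by move=> k; exact: measurableI.
- by move=> x _; rewrite lee_fin.
- exact: trivIset_setIr.
Qed.

HB.instance Definition _ := isMeasure.Build _ _ _ density_measure
  density0 density_ge0 density_sigma_additive.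

Let density_npos : density_measure `]-oo, 0%R]%classic = 0%E.
Proof.
rewrite /density_measure /pos_density (_ : _ `&` _ = set0) ?integral_set0//.
apply/seteqP; split => // x /= []; rewrite !in_itv/= andbT => x0.
by rewrite ltNge x0.
Qed.

Let density_sigma_finite : sigma_finite setT density_measure.
Proof.
have [F FT Ffin] := sigma_finiteT m; exists F => // i; have [mF Foo] := Ffin i.
split => //; have mFD : measurable (F i `&` D) by exact: measurableI.
have K0 : 0 <= K := le_trans (g0 0) (gK 0).
apply: (@le_lt_trans _ _ (\int[m]_(x in F i `&` D) K%:E)%E).
  by apply: ge0_le_integral => // x _; rewrite lee_fin.
rewrite integral_cst// lte_mul_pinfty ?lee_fin//.
by apply: le_lt_trans Foo; apply: le_measure; rewrite ?inE.
Qed.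

HB.instance Definition _ := @Measure_isSigmaFinite.Build _ _ _
  density_measure density_sigma_finite.

(** Boundedness of g is what keeps the measure sigma-finite, on the cover that
serves for m. *)
Definition density_pos_measure : pos_measure R :=
  @PosMeasure R density_measure density_npos.

End density.

Section mconv_density.
Context {R : realType}.
Notation D := (`]0%R, +oo[%classic : set R).
Variables (alpha : R) (rho : pos_measure R).
Notation nua := (nu_measure alpha).
Let mD : measurable D. Proof. exact: measurable_itv. Qed.

(** On each fibre the dilation z = y x produces the factor y^alpha by homogeneity
of nu_alpha; Tonelli then moves the integral over rho inside.  The density is
given as a function of ln x because that is where dilations become
translations. *)
Lemma mconv_density (nu : pos_measure R) (g : R -> R) (B : set (measurableTypeR R)) :
  measurable_fun setT g -> (forall x, 0 <= g x) ->
  eq_pos_measure nu (pos_density nua (fun x => g (ln x))) -> measurable B -> B `<=` D ->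
  mconv nu rho B = (\int[nua]_(z in D) ((\1_B z)%:E *
    \int[rho]_(y in D) (expR (alpha * ln y) * g (ln z - ln y)%R)%:E))%E.
Proof.
move=> mg g0 nug mB BD.
have mBf : measurable_fun setT (\1_B : R -> R) by exact: measurable_indic.
have mgy y : measurable_fun setT (fun z : R => g (ln z - ln y)).
  by apply: measurableT_comp => //; exact: measurable_funB.
transitivity (\int[rho]_(y in D) \int[nua]_(z in D)
    (expR (alpha * ln y) * (\1_B z * g (ln z - ln y)%R))%:E)%E.
  rewrite /mconv; apply: eq_integral => y /set_mem/=; rewrite in_itv/= andbT => y0.
  have img : [set y^-1 * b | b in B] = (fun x : R => y * x) @^-1` B.
    apply/seteqP; split=> x /=; first by move=> [b Bb <-]; rewrite mulVKf// gt_eqF.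
    by move=> Bx; exists (y * x) => //; rewrite mulKf// gt_eqF.
  have my : measurable_fun setT (fun x : measurableTypeR R => y * x : measurableTypeR R).
    by apply: measurable_funM.
  have mimg : measurable [set y^-1 * b | b in B].
    by rewrite img -[_ @^-1` _]setTI; exact: my.
  have imgD : [set y^-1 * b | b in B] `<=` D.
    move=> _ [b Bb <-]; have := BD _ Bb.
    by rewrite /= !in_itv/= !andbT => b0; rewrite mulr_gt0// invr_gt0.
  pose G z := (\1_B z * g (ln z - ln y))%:E.
  have mG : measurable_fun setT G by apply/measurable_EFinP; exact: (measurable_funM mBf (mgy y)).
  have G0 z : (0 <= G z)%E by rewrite lee_fin mulr_ge0// indicE ler0n.
  transitivity (\int[nua]_(x in D) G (y * x)%R)%E.
    rewrite nug// /pos_density setIidl// integral_mkcond [RHS]integral_mkcond.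
    apply: eq_integral => x _; rewrite !patchE img.
    rewrite /G indicE (_ : (y * x \in B) = (x \in (fun x : R => y * x) @^-1` B)); last first.
      by apply/idP/idP => /set_mem h; apply/mem_set.
    have [xB|xB] := boolP (x \in _ @^-1` _); last by rewrite mul0r if_same.
    have xD : D x by apply: imgD; rewrite img; exact: set_mem.
    have x0 : 0 < x by move: xD; rewrite /= in_itv/= andbT.
    by rewrite mul1r ifT ?inE// lnM ?posrE// [ln y + _]addrC addrK.
  rewrite integral_nu_dilation//.
  rewrite -(@ge0_integralZl _ (measurableTypeR R) R nua D mD G
    (measurable_funTS mG) _ (fun x _ => G0 x))//.
(* The indicators extend the integrals to the whole line, where Tonelli
   applies. *)
pose f (z : measurableTypeR R * measurableTypeR R) : \bar R :=
  (\1_D z.1 * \1_D z.2 * (expR (alpha * ln z.1) * (\1_B z.2 * g (ln z.2 - ln z.1))))%:E.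
have f0 z : (0 <= f z)%E.
  by rewrite lee_fin !mulr_ge0 ?expR_ge0// indicE ler0n.
have mDf : measurable_fun setT (\1_D : R -> R) by exact: measurable_indic.
have mf : measurable_fun setT f.
  apply/measurable_EFinP; apply: measurable_funM.
    by apply: measurable_funM; exact: measurableT_comp.
  apply: measurable_funM; first exact: (measurableT_comp (measurable_pow alpha)).
  apply: measurable_funM; first exact: measurableT_comp.
  apply: measurableT_comp => //; apply: measurable_funB => //.
    exact: measurableT_comp.
  exact: measurableT_comp.
have := @fubini_tonelli _ _ _ _ R rho nua f mf f0.
have -> : (\int[rho]_x \int[nua]_y f (x, y) = \int[rho]_(y in D) \int[nua]_(z in D)
    (expR (alpha * ln y) * (\1_B z * g (ln z - ln y)%R))%:E)%E.
  rewrite [RHS]integral_mkcond; apply: eq_integral => y _; rewrite patchE /f /=.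
  have [yD|yD] := boolP (y \in D); last first.
    by rewrite integral0_eq// => z _; rewrite indicE (negbTE yD) !mul0r.
  rewrite [RHS]integral_mkcond; apply: eq_integral => z _.
  rewrite patchE !indicE yD; case: (z \in D); by rewrite ?mul1r ?mulr0 ?mul0r.
move=> ->; rewrite [RHS]integral_mkcond; apply: eq_integral => z _.
rewrite patchE /f /=; have [zD|zD] := boolP (z \in D); last first.
  by rewrite integral0_eq// => y _; rewrite [\1__ z]indicE (negbTE zD) mulr0 !mul0r.
have mgz : measurable_fun D (fun y => (expR (alpha * ln y) * g (ln z - ln y))%:E).
  apply/measurable_EFinP/measurable_funTS; apply: measurable_funM.
    exact: measurable_pow.
  by apply: measurableT_comp => //; exact: measurable_funB.
rewrite -(@ge0_integralZl _ (measurableTypeR R) R rho D mD _ mgz)//; last first.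
  by move=> y _; rewrite lee_fin mulr_ge0 ?expR_ge0.
rewrite [RHS]integral_mkcond; apply: eq_integral => y _.
rewrite patchE !indicE zD; case: (y \in D); rewrite ?mul1r ?mulr0 ?mul0r//.
by rewrite mulrCA.
Qed.

End mconv_density.

(** * The Mellin transform and the moment condition *)

Section moments.
Context {R : realType}.
Variables (alpha : R) (rho : pos_measure R).
Notation D := (`]0%R, +oo[%classic : set R).
Let mD : measurable (D : set (measurableTypeR R)). Proof. exact: measurable_itv. Qed.
Let W := (fun y => expR (alpha * ln y)) \_ D.

Lemma mellinE theta : mellin rho (alpha +i* theta) =
  (trig_tr rho (@ln R) W 0 theta +i* trig_tr rho (@ln R) W (- (pi / 2)) theta).
Proof.
rewrite /mellin /cintegral /trig_tr !Rintegral_pow; congr (_ +i* _).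
  by apply: eq_Rintegral => y _; rewrite addr0.
by apply: eq_Rintegral => y _; rewrite cosBpihalf.
Qed.

Lemma integrable_pow (c : R -> R) : measurable_fun setT c ->
  rho.-integrable D (EFin \o (fun y => expR (alpha * ln y) * c y)) ->
  rho.-integrable setT (EFin \o (fun y => W y * c y)).
Proof.
move=> mc; rewrite integrable_mkcond//; apply: eq_integrable => // y _.
by rewrite /= /W !patchE; case: ifP => _; rewrite /= ?mul0r.
Qed.

Hypothesis moment : exists2 delta : R, 0 < delta &
  (\int[rho]_(y in D) (Num.max (y `^ (alpha - delta)) (y `^ (alpha + delta)))%:E < +oo)%E.

(** The maximum of the two powers dominates y^alpha exp(delta |ln y|), and
the exponential dominates any function of quadratic growth. *)
Lemma integrable_log_moment (c : R -> R) (K : R) : measurable_fun setT c ->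
  (forall z, `|c z| <= K * (1 + z ^+ 2)) ->
  rho.-integrable setT (EFin \o (fun y => W y * c (ln y))).
Proof.
move=> mc cK; have [delta d0 fin] := moment.
have mcl : measurable_fun setT (fun y : R => c (ln y)) by exact: measurableT_comp.
apply: integrable_pow => //.
pose mx (y : R) := Num.max (y `^ (alpha - delta)) (y `^ (alpha + delta)).
have mmx : measurable_fun setT mx.
  by apply: measurable_maxr; exact: measurable_powR.
have imx : rho.-integrable D (EFin \o mx).
  apply/integrableP; split; first by apply/measurable_EFinP/measurable_funTS.
  apply: le_lt_trans fin; rewrite le_eqVlt; apply/orP; left; apply/eqP.
  by apply: eq_integral => y _; rewrite /= ger0_norm// le_max powR_ge0.
have K0 : 0 <= K by have := cK 0; rewrite expr0n/= addr0 mulr1; exact: le_trans.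
pose k := K * (1 + 4 / delta ^+ 2).
have k0 : 0 <= k by rewrite mulr_ge0// addr_ge0// divr_ge0// sqr_ge0.
apply: (@le_integrable _ _ _ rho D mD _ (EFin \o (fun y => k * mx y))).
- apply/measurable_EFinP/measurable_funTS; apply: measurable_funM => //.
  exact: measurable_pow.
- move=> y; rewrite /= in_itv/= andbT => y0.
  rewrite lee_fin normrM ger0_norm ?expR_ge0// [leRHS]ger0_norm; last first.
    by rewrite mulr_ge0// le_max powR_ge0.
  set z := ln y.
  have le_mx : expR (alpha * z) * expR (delta * `|z|) <= mx y.
    rewrite /mx /powR gt_eqF// -expRD le_max !ler_expR -/z.
    have [z0|z0] := lerP 0 z.
      by apply/orP; right; rewrite ger0_norm// mulrDl lexx.
    by apply/orP; left; rewrite ltr0_norm// mulrBl mulrN lexx.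
  have e1 : 1 <= expR (delta * `|z|) by rewrite -expR0 ler_expR mulr_ge0// ltW.
  (* The square of u <= exp u at u = delta |z| / 2. *)
  have e2 : z ^+ 2 <= 4 / delta ^+ 2 * expR (delta * `|z|).
    have -> : expR (delta * `|z|) = expR (delta * `|z| / 2) ^+ 2.
      by rewrite expr2 -expRD; congr expR; field.
    have h : delta * `|z| / 2 <= expR (delta * `|z| / 2).
      by apply: le_trans (expR_ge1Dx _); rewrite lerDr.
    have -> : z ^+ 2 = 4 / delta ^+ 2 * (delta * `|z| / 2) ^+ 2.
      by rewrite !exprMn real_normK ?num_real// exprVn; field; rewrite gt_eqF.
    rewrite ler_wpM2l ?divr_ge0 ?sqr_ge0// ler_sqr ?nnegrE ?expR_ge0//.
    by rewrite divr_ge0// mulr_ge0// ltW.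
  apply: (@le_trans _ _ (k * (expR (alpha * z) * expR (delta * `|z|)))); last first.
    exact: ler_wpM2l.
  rewrite [leRHS]mulrCA; apply: ler_wpM2l; first exact: expR_ge0.
  apply: (le_trans (cK z)); rewrite /k -mulrA; apply: ler_wpM2l => //.
  by rewrite mulrDl mul1r; apply: lerD.
- have := integrableZl mD k imx.
  by apply: eq_integrable => // y _ /=; rewrite EFinM.
Qed.

Lemma integrable_W : rho.-integrable setT (EFin \o W).
Proof.
have h (z : R) : `|cst (1 : R) z| <= 1 * (1 + z ^+ 2).
  by rewrite /= normr1 mul1r lerDl sqr_ge0.
have := integrable_log_moment (measurable_cst _) h.
by apply: eq_integrable => // y _; rewrite /= mulr1.
Qed.

Lemma integrable_Wln2 :
  rho.-integrable setT (EFin \o (fun y => W y * ln y * ln y)).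
Proof.
have h (z : R) : `|z * z| <= 1 * (1 + z ^+ 2).
  by rewrite -expr2 ger0_norm ?sqr_ge0// mul1r lerDr.
have mzz : measurable_fun setT (fun z : R => z * z) by exact: measurable_funM.
have := integrable_log_moment mzz h.
by apply: eq_integrable => // y _; rewrite /= mulrA.
Qed.

(** At a zero of the Mellin transform both oscillating terms integrate to 0. *)
Lemma modulated_mass theta (p q : R) :
  mellin rho (alpha +i* theta) = 0 ->
  \int[rho]_(y in D) (expR (alpha * ln y) *
    (1 + p * cos (theta * ln y) + q * sin (theta * ln y))) =
  \int[rho]_(y in D) expR (alpha * ln y).
Proof.
rewrite mellinE => /eqP; rewrite eq_complex/= => /andP[/eqP C0 /eqP S0].
have i1 := integrable_W.
have mln : measurable_fun [set: measurableTypeR R] (@ln R) by exact: measurable_ln.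
have ic := integrable_cosX mln 0 theta i1.
have is_ := integrable_cosX mln (- (pi / 2)) theta i1.
have iz (k : R) (h : R -> R) : rho.-integrable setT (EFin \o h) ->
    rho.-integrable setT (EFin \o (fun y => k * h y)).
  move=> ih; have := integrableZl measurableT k ih.
  by apply: eq_integrable => // y _ /=; rewrite EFinM.
rewrite -Rintegral_pow.
transitivity (\int[rho]_y ((W y + p * (W y * cos (theta * ln y + 0))) +
   q * (W y * cos (theta * ln y - pi / 2)))).
  by apply: eq_Rintegral => y _; rewrite addr0 cosBpihalf -/W; ring.
have ip : rho.-integrable setT
    (EFin \o (fun y => W y + p * (W y * cos (theta * ln y + 0)))).
  have := integrableD measurableT i1 (iz p _ ic).
  by apply: eq_integrable => // y _.
rewrite RintegralD//; last exact: (iz q _ is_).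
rewrite RintegralD//; last exact: (iz p _ ic).
rewrite (RintegralZl _ measurableT ic) (RintegralZl _ measurableT is_).
rewrite -/(trig_tr rho (@ln R) W 0 theta) -/(trig_tr rho (@ln R) W (- (pi / 2)) theta).
rewrite C0 S0 !mulr0 !addr0.
transitivity (\int[rho]_y (W y * 1)).
  by apply: eq_Rintegral => y _; rewrite mulr1.
by rewrite Rintegral_pow; apply: eq_Rintegral => y _; rewrite mulr1.
Qed.

End moments.

(** * Oscillating densities at a zero of the Mellin transform *)

Section modulation.
Context {R : realType}.
Variables (alpha : R) (rho : pos_measure R).
Notation D := (`]0%R, +oo[%classic : set R).
Notation nua := (nu_measure alpha).
Let mD : measurable (D : set (measurableTypeR R)). Proof. exact: measurable_itv. Qed.
Let W := (fun y => expR (alpha * ln y)) \_ D.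
Hypothesis moment : exists2 delta : R, 0 < delta &
  (\int[rho]_(y in D) (Num.max (y `^ (alpha - delta)) (y `^ (alpha + delta)))%:E < +oo)%E.

Definition modulation (theta a b z : R) : R :=
  1 + a * cos (theta * z) + b * sin (theta * z).

(** By Cauchy-Schwarz, in the form of Lagrange's identity. *)
Lemma modulation_bounds theta a b z : a ^+ 2 + b ^+ 2 <= 1 ->
  0 <= modulation theta a b z <= 2.
Proof.
move=> ab; rewrite /modulation.
have := cos2Dsin2 (theta * z); set c := cos _; set s := sin _ => cs.
have : (a * c + b * s) ^+ 2 <= 1.
  have -> : (a * c + b * s) ^+ 2 =
      (a ^+ 2 + b ^+ 2) * (c ^+ 2 + s ^+ 2) - (a * s - b * c) ^+ 2 by ring.
  by rewrite cs mulr1 lerBlDr (le_trans ab)// lerDl sqr_ge0.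
by move=> h; apply/andP; split; nra.
Qed.

Lemma measurable_modulation theta a b : measurable_fun setT (modulation theta a b).
Proof.
apply: measurable_funD; last first.
  apply: measurable_funM => //; apply: measurableT_comp; last exact: measurable_funM.
  by apply: continuous_measurable_fun; exact: continuous_sin.
apply: measurable_funD => //; apply: measurable_funM => //.
apply: measurableT_comp; last exact: measurable_funM.
by apply: continuous_measurable_fun; exact: continuous_cos.
Qed.

Lemma mconv_modulation theta a b (nu : pos_measure R) :
  mellin rho (alpha +i* theta) = 0 -> a ^+ 2 + b ^+ 2 <= 1 ->
  eq_pos_measure nu (pos_density nua (fun x => modulation theta a b (ln x))) ->
  eq_pos_measure (mconv nu rho) (mconv nua rho).
Proof.
move=> C0 ab nuE B mB BD.
have g0 z : 0 <= modulation theta a b z.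
  by have /andP[] := modulation_bounds theta z ab.
have nua1 : eq_pos_measure nua (pos_density nua (fun x => cst 1 (ln x))).
  move=> A mA AD; rewrite /pos_density setIidl//.
  rewrite (_ : (fun x : measurableTypeR R => _) = cst 1%E)//.
  by rewrite integral_cst// mul1e.
rewrite (mconv_density rho (measurable_modulation theta a b) g0 nuE mB BD).
rewrite (@mconv_density R alpha rho nua (cst 1) B (measurable_cst _) (fun=> ler01)
  nua1 mB BD).
apply: eq_integral => z _; congr (_ * _)%E.
have mln : measurable_fun [set: measurableTypeR R] (@ln R) by exact: measurable_ln.
have iW := integrable_W moment.
have toW (c : R -> R) (K : R) : measurable_fun [set: measurableTypeR R] c ->
    (forall x, `|c x| <= K) ->
    rho.-integrable D (EFin \o (fun y => expR (alpha * ln y) * c y)).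
  move=> mc cK; rewrite integrable_mkcond//.
  have := integrable_Mbounded iW mc cK.
  apply: eq_integrable => // y _; rewrite /= /W !patchE; case: ifP => _ //=.
  by rewrite mul0r.
have mo : measurable_fun [set: measurableTypeR R]
    (fun y : R => modulation theta a b (ln z - ln y)).
  by apply: (measurableT_comp (measurable_modulation theta a b)); exact: measurable_funB.
have i1 := toW _ 2 mo (fun y => _).
have i2 := toW (cst 1) 1 (measurable_cst _) (fun y => _).
rewrite -[LHS]fineK; last first.
  apply: (integrable_fin_num mD); apply: i1 => y.
  have /andP[h0 h2] := modulation_bounds theta (ln z - ln y) ab.
  by rewrite ger0_norm.
rewrite -[RHS]fineK; last first.
  by apply: (integrable_fin_num mD); apply: i2; rewrite /= normr1.
congr (_%:E).
(* The coefficients of cos (theta ln y) and sin (theta ln y) after expanding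
   the modulation at ln z - ln y. *)
have := @modulated_mass R alpha rho moment theta
  (a * cos (theta * ln z) + b * sin (theta * ln z))
  (a * sin (theta * ln z) - b * cos (theta * ln z)) C0.
rewrite /Rintegral => h; transitivity (fine (\int[rho]_(y in D)
  (expR (alpha * ln y) *
   (1 + (a * cos (theta * ln z) + b * sin (theta * ln z)) * cos (theta * ln y) +
    (a * sin (theta * ln z) - b * cos (theta * ln z)) * sin (theta * ln y)))%:E)).
  congr fine; apply: eq_integral => y _; congr (_%:E).
  by rewrite /modulation mulrBr cosB sinB; ring.
rewrite h; congr fine; apply: eq_integral => y _.
by rewrite mulr1.
Qed.

End modulation.

Theorem theorem2p1 (R : realType) (alpha : R) (rho : pos_measure R)
    (rho_neq0 : ~ eq_pos_measure rho mzero)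
    (rho_moment : exists2 delta : R, 0 < delta &
      (\int[rho]_(y in `]0%R, +oo[)
         (Num.max (y `^ (alpha - delta)) (y `^ (alpha + delta)))%:E < +oo)%E) :
  (cancellation_property rho [set nu_measure alpha] <->
     (forall theta : R, mellin rho (alpha +i* theta) <> 0)) /\
  (forall theta0 : R, mellin rho (alpha +i* theta0) = 0 ->
     forall a b : R, 0 < a ^+ 2 + b ^+ 2 -> a ^+ 2 + b ^+ 2 <= 1 ->
     exists nu : pos_measure R,
       eq_pos_measure nu (pos_density (nu_measure alpha)
         (fun x => 1 + a * cos (theta0 * ln x) + b * sin (theta0 * ln x))) /\
       eq_pos_measure (mconv nu rho) (mconv (nu_measure alpha) rho)).
Proof.
have osc theta a b : mellin rho (alpha +i* theta) = 0 -> a ^+ 2 + b ^+ 2 <= 1 ->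
    exists nu : pos_measure R,
       eq_pos_measure nu (pos_density (nu_measure alpha)
         (fun x => 1 + a * cos (theta * ln x) + b * sin (theta * ln x))) /\
       eq_pos_measure (mconv nu rho) (mconv (nu_measure alpha) rho).
  move=> m0 ab.
  have mg : measurable_fun setT (fun x : R => modulation theta a b (ln x)).
    apply: (measurableT_comp (measurable_modulation theta a b)).
    exact: measurable_ln.
  have g0 x : 0 <= modulation theta a b (ln x).
    by have /andP[] := modulation_bounds theta (ln x) ab.
  have g2 x : modulation theta a b (ln x) <= 2.
    by have /andP[] := modulation_bounds theta (ln x) ab.
  exists (density_pos_measure (nu_measure alpha) mg g0 g2); split.
    by move=> B _ _.
  by apply: (mconv_modulation rho_moment m0 ab) => B _ _.
split; last by move=> theta m0 a b _ ab; exact: osc.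
split=> [cancel theta m0|nz nu _ -> conv].
  have [|nu [nuE conv]] := osc theta 1 0 m0.
    by rewrite expr1n expr0n addr0.
  have := cancel nu (nu_measure alpha) erefl conv.
  (* For 1 < x < q, |theta ln x| <= 1, so the cosine is at least cos 1 > 0. *)
  pose q := expR ((`|theta| + 1)^-1).
  have q1 : 1 < q by rewrite -expR0 ltr_expR invr_gt0 ltr_wpDl.
  pose I : set (measurableTypeR R) := `]1, q[%classic.
  have mI : measurable I by exact: measurable_itv.
  have ID : I `<=` `]0, +oo[.
    by move=> x; rewrite /I /= !in_itv/= andbT => /andP[+ _]; exact: lt_trans.
  move=> /(_ I mI ID); rewrite nuE// /pos_density setIidl// => nuI.
  have nuI_gt0 := @nu_itv_gt0 R alpha 1 q ltr01 q1.
  have nuI_fin := @nu_itv_lty R alpha 1 q ltr01 q1.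
  have c0 : 0 < cos 1 :> R := cos1_gt0 R.
  have : ((1 + cos 1)%:E * nu_measure alpha I <= nu_measure alpha I)%E.
    rewrite -[leRHS]nuI -integral_cst//; apply: ge0_le_integral => //.
    - by move=> x _; rewrite lee_fin addr_ge0// ltW.
    - apply/measurable_EFinP/measurable_funTS.
      have mln : measurable_fun [set: measurableTypeR R] (@ln R) by exact: measurable_ln.
      exact: (measurableT_comp (measurable_modulation theta 1 0) mln).
    move=> x; rewrite /I /= in_itv/= => /andP[x1 xq].
    have x0 : 0 < x := lt_trans ltr01 x1.
    rewrite lee_fin mul0r addr0 mul1r lerD2l -(cos_norm (theta * ln x)).
    have lnx0 : 0 <= ln x by rewrite ln_ge0// ltW.
    have tl : `|theta * ln x| <= 1.
      have : ln x <= (`|theta| + 1)^-1.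
        by rewrite -ler_expR lnK ?posrE// ltW.
      rewrite -div1r ler_pdivlMr ?ltr_wpDl// => h.
      rewrite normrM (ger0_norm lnx0) mulrC (le_trans _ h)//.
      by rewrite ler_wpM2l// lerDl.
    have p1 := @pihalf_ge1 R.
    move: tl; rewrite le_eqVlt => /predU1P[->//|tl]; rewrite ltW// ltr_cos//.
    + by rewrite in_itv/= normr_ge0; lra.
    + by rewrite in_itv/=; apply/andP; split; lra.
  rewrite -[X in (X <= _)%E]/((_ * _)%E) leNgt => /negP; apply.
  rewrite -[X in (X < _)%E]mul1e lte_pmul2r ?lte_fin ?ltrDl//.
  by rewrite ge0_fin_numE// ltW.
apply: (cancel_nu rho_neq0 conv (integrable_W rho_moment)
  (integrable_Wln2 rho_moment)) => theta.
have := nz theta; rewrite mellinE; apply: contra_not_neq.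
move=> /eqP; rewrite paddr_eq0 ?sqr_ge0// !sqrf_eq0 => /andP[/eqP C0 /eqP S0].
by rewrite C0 S0.
Qed.
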